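(* Let $a,c$ be nonzero complex numbers and let $\ell,m,n$ be nonnegative integers with $\ell\le n$. Then $$ {}_4\phi_3\left[\begin{matrix}q^{-n},\,q^{1-\ell+n},\,\sqrt{qac},\,-q^{m}\sqrt{qac}\\ -q,\,q^{1-\ell+m}a,\,qc\end{matrix};q,q\right] =\frac{(q^{-n}\sqrt{qa/c},\,-q^{m-n}\sqrt{qa/c},\,q^{1-\ell+n};q)_n}{(q^{1-\ell+m}a,\,q^{-n}/c,\,-q;q)_n}\, \frac{(q^{m-n}a,\,\sqrt{qac};q)_m}{(q^{m}ac,\,q^{-n}\sqrt{qa/c};q)_m}\sum_{i=0}^{\ell}\sum_{j=0}^{m}T_{i,j}, $$ where $$ T_{i,j}=q^{(\ell-n)i+\binom{i+1}{2}+(n+\frac52)j}\Big(\frac{c}{a}\Big)^{j/2}\,\frac{1-q^{2m-2j}ac}{1-q^{2m}ac}\, \frac{(q^{-m},\,q^{-n}/c,\,q^{-2m}/(ac);q)_j}{(q,\,q^{1-2m+n}/a,\,q^{1-m}/(ac);q)_j} $$ $$ \times\frac{(q^{-\ell},\,q^{-n},\,-q^{-n},\,q^{2m-n-j}a,\,q^{j-n}/c;q)_i}{(q,\,q^{m-n}\sqrt{qa/c},\,-q^{m-n}\sqrt{qa/c},\,q^{\ell-2n},\,q^{i-2n-1};q)_i}\, \frac{(q^{1+2m-n+i-j}a,\,q^{1-n+i+j}/c;q^2)_{n-i}}{(q,\,q^{1+2m-2n+2i}a/c;q^2)_{n-i}}. $$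
   Context: $q$ is a nonzero complex number. For complex $x$ and an integer $n\ge 0$, the $q$-shifted factorial is $(x;q)_0=1$, $(x;q)_n=\prod_{k=0}^{n-1}(1-xq^k)$, and $(x_1,\dots,x_r;q)_n=\prod_{s=1}^r (x_s;q)_n$ (likewise with base $q^2$ in place of $q$). The basic hypergeometric series is ${}_4\phi_3\left[\begin{matrix}a_0,a_1,a_2,a_3\\ b_1,b_2,b_3\end{matrix};q,z\right]=\sum_{k\ge0}\frac{(a_0,a_1,a_2,a_3;q)_k}{(q,b_1,b_2,b_3;q)_k}z^k$. Here one upper parameter is $q^{-n}$, so the series terminates and means the sum over $0\le k\le n$. Parameters are assumed to be such that no zero factor appears in a denominator of the displayed expressions. Square roots $q^{1/2},a^{1/2},c^{1/2}$ are fixed once and for all and used multiplicatively: $\sqrt{qac}=q^{1/2}a^{1/2}c^{1/2}$, $\sqrt{qa/c}=q^{1/2}a^{1/2}/c^{1/2}$, $(c/a)^{j/2}=(c^{1/2}/a^{1/2})^j$, $q^{5j/2}=(q^{1/2})^{5j}$. *)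

(* Defs.v *)
From mathcomp Require Import all_boot all_order all_algebra.
From mathcomp Require Import reals complex.

Set Implicit Arguments.
Unset Strict Implicit.
Unset Printing Implicit Defensive.

Import GRing.Theory.
Local Open Scope ring_scope.

Section QSeries.
Variable F : fieldType.

Definition qpoch (x q : F) (n : nat) : F := \prod_(k < n) (1 - x * q ^+ k).

Definition qpochs (xs : seq F) (q : F) (n : nat) : F :=
  \prod_(x <- xs) qpoch x q n.

(* The series 4phi3 cut after k = n. It is meant for a0 = q^(-n): all later
   terms then contain the factor (q^(-n); q)_k = 0, and the denominators are
   only required to be nonzero for k <= n. *)
Definition phi43 (n : nat) (a0 a1 a2 a3 b1 b2 b3 q z : F) : F :=
  \sum_(k < n.+1)
    qpochs [:: a0; a1; a2; a3] q k / qpochs [:: q; b1; b2; b3] q k * z ^+ k.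

(* qh, ah, ch are the chosen square roots of q, a, c. The truncated
   subtraction (n - i)%N is only used for i <= l <= n. *)
Definition Tterm (q a c qh ah ch : F) (l m n i j : nat) : F :=
  let u := qh * ah / ch in
  q ^ ((l%:Z - n%:Z) * i%:Z + 'C(i.+1, 2)%:Z + n%:Z * j%:Z) * qh ^+ (5 * j)
  * (ch / ah) ^+ j
  * ((1 - q ^ (2 * m%:Z - 2 * j%:Z) * a * c) / (1 - q ^+ (2 * m) * a * c))
  * (qpochs [:: q ^ (- m%:Z); q ^ (- n%:Z) / c; q ^ (- 2 * m%:Z) / (a * c)] q j
     / qpochs [:: q; q ^ (1 - 2 * m%:Z + n%:Z) / a;
                  q ^ (1 - m%:Z) / (a * c)] q j)
  * (qpochs [:: q ^ (- l%:Z); q ^ (- n%:Z); - q ^ (- n%:Z);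
                q ^ (2 * m%:Z - n%:Z - j%:Z) * a; q ^ (j%:Z - n%:Z) / c] q i
     / qpochs [:: q; q ^ (m%:Z - n%:Z) * u; - (q ^ (m%:Z - n%:Z) * u);
                  q ^ (l%:Z - 2 * n%:Z); q ^ (i%:Z - 2 * n%:Z - 1)] q i)
  * (qpochs [:: q ^ (1 + 2 * m%:Z - n%:Z + i%:Z - j%:Z) * a;
                q ^ (1 - n%:Z + i%:Z + j%:Z) / c] (q ^+ 2) (n - i)
     / qpochs [:: q; q ^ (1 + 2 * m%:Z - 2 * n%:Z + 2 * i%:Z) * a / c]
              (q ^+ 2) (n - i)).

End QSeries.

(* Main.v *)
Require Import Defs.
From mathcomp Require Import all_boot all_order all_algebra.
From mathcomp Require Import ring zify.
From mathcomp Require Import reals complex.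

Set Implicit Arguments.
Unset Strict Implicit.
Unset Printing Implicit Defensive.

Import GRing.Theory.
Local Open Scope ring_scope.

(** Sears' transformation, read backwards, turns the left-hand side into a
    prefactor times
      4phi3(q^-n, -q^(l-n), A, B; q^(l-2n), v, -q^m v; q, q),
    A = q^(m-n) a, B = q^-n / c, v = q^-n sqrt(qa/c), so that
    v^2 = q^(1-m) A B.  For l = m = 0 this is Andrews' terminating q-Watson
    sum.  The integers m and l are removed by two instances of the terminating
    very-well-poised 6phi5 sum with d^2 = alpha q: one expands
    (A, B)_k / (v)_k in the functions (q^(m-j) A, q^j B)_k / (q^m v)_k, the
    other expands (-q^(l-n))_k / (q^(l-2n))_k, and each (i, j) leaves a
    q-Watson sum of length n - i.

    The 6phi5 sum, the q-Saalschutz sum and the q-Watson sum are all used as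
    expansions of a product of linear factors in a basis of such products.  In
    this form each is proved by multiplying by one more linear factor, written
    as a combination of the two factors that lead to the next basis elements,
    as in Pascal's rule. *)

(** * Sums over pairs j + d = m and a Pascal-type recurrence *)

Ltac field_nz :=
  field; rewrite -?andbA; do ?[apply/andP; split];
  rewrite ?oppr_eq0 ?oner_neq0 //; auto.

(** The inductive step common to all three expansions. A term at (j, d) of level m feeds two terms
    of level m + 1: [g] is its contribution to (j, d + 1) and [h] its contribution to (j + 1, d).
    The two end terms receive one contribution each, all others two. *)
Lemma sum_pascal (V : nmodType) (f g h : nat -> nat -> V) (m : nat) :
  f 0%N m.+1 = g 0%N m -> f m.+1 0%N = h m 0%N ->
  (forall j d, (j + d).+1 = m -> f j.+1 d.+1 = g j.+1 d + h j d.+1) ->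
  \sum_(j < m.+2) f j (m.+1 - j)%N = \sum_(j < m.+1) (g j (m - j)%N + h j (m - j)%N).
Proof.
move=> f0 fm fS; rewrite big_ord_recl big_ord_recr /= !subn0 subnn f0 fm big_split /=.
rewrite [in RHS]big_ord_recl [in X in _ = _ + X]big_ord_recr /= subn0 subnn.
rewrite (eq_bigr (fun i : 'I_m => g (bump 0 i) (m - bump 0 i)%N + h i (m - i)%N)).
  by rewrite big_split /= !addrA.
case=> i /= im _; rewrite /bump /= add1n subSS.
have [d dm] : exists d, m = (i + d).+1 by exists (m - i.+1)%N; rewrite -addSn subnKC.
by rewrite dm subSS addKn -addnS addKn fS.
Qed.

(** Allows summands to be compared with j and d as free variables, so that no truncated subtraction
    enters the algebra. *)
Lemma ord_sumE (V : nmodType) (f g : nat -> nat -> V) (m : nat) :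
  (forall j d, (j + d)%N = m -> f j d = g j d) ->
  \sum_(j < m.+1) f j (m - j)%N = \sum_(j < m.+1) g j (m - j)%N.
Proof. by move=> fg; apply: eq_bigr => -[j /= jm] _; apply: fg; rewrite subnKC. Qed.

Lemma bin2_sq n : ('C(n, 2) + 'C(n, 2) + n = n * n)%N.
Proof. by elim: n => // n IH; rewrite binS bin1 mulSn mulnS -IH; ring. Qed.

(** * Splitting and reversal of q-shifted factorials *)

Section Qpoch.
Variables (F : fieldType) (q : F).

Lemma qpoch0 (x : F) : qpoch x q 0 = 1.
Proof. by rewrite /qpoch big_ord0. Qed.

Lemma qpochSr (x : F) n : qpoch x q n.+1 = qpoch x q n * (1 - x * q ^+ n).
Proof. by rewrite /qpoch big_ord_recr. Qed.

Lemma qpochD (x : F) m n :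
  qpoch x q (m + n) = qpoch x q m * qpoch (x * q ^+ m) q n.
Proof.
elim: n => [|n IH]; first by rewrite addn0 qpoch0 mulr1.
by rewrite addnS !qpochSr IH -!mulrA -exprD.
Qed.

Lemma qpochSl (x : F) n : qpoch x q n.+1 = (1 - x) * qpoch (x * q) q n.
Proof. by rewrite -add1n qpochD qpochSr qpoch0 expr0 expr1 mulr1 mul1r. Qed.

Lemma qpoch_neq0P (x : F) n :
  reflect (forall k, (k < n)%N -> 1 - x * q ^+ k != 0) (qpoch x q n != 0).
Proof.
apply: (iffP idP) => [/prodf_neq0 H k kn|H].
  exact: (H (Ordinal kn) isT).
by apply/prodf_neq0 => -[k kn] _; apply: H.
Qed.

Lemma qpoch_neq0_le (x : F) m n :
  (m <= n)%N -> qpoch x q n != 0 -> qpoch x q m != 0.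
Proof. by move=> mn /qpoch_neq0P H; apply/qpoch_neq0P => k /leq_trans-/(_ n mn) /H. Qed.

(** Each factor is written as [1 - y q^t = -y q^t (1 - q^(-t) / y)]; read backwards, the new factors
    form a factorial with first parameter [q^(1-r) / y]. *)
Lemma qpoch_rev (y : F) r : q != 0 -> y != 0 ->
  qpoch y q r = qpoch (q / (q ^+ r * y)) q r * ((-1) ^+ r * y ^+ r * q ^+ 'C(r, 2)).
Proof.
move=> q0 y0; elim: r => [|r IH]; first by rewrite !qpoch0 !expr0 !mulr1.
rewrite qpochSr IH qpochSl.
have -> : q / (q ^+ r.+1 * y) * q = q / (q ^+ r * y).
  by rewrite exprS; have := expf_neq0 r q0 => ?; field_nz.
rewrite (binS r) bin1 exprD !exprS; have := expf_neq0 r q0 => ?; field_nz.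
Qed.

(** Only the last j factors are reversed. This is how factorials of length N - r turn into
    factorials of length r with negative powers of q, and back. *)
Lemma qpoch_rev_split (y : F) k j : q != 0 -> y != 0 ->
  qpoch y q (k + j) =
  qpoch y q k * qpoch (q / (q ^+ (k + j) * y)) q j
    * ((-1) ^+ j * y ^+ j * q ^+ (k * j) * q ^+ 'C(j, 2)).
Proof.
move=> q0 y0; rewrite qpochD (@qpoch_rev (y * _)) ?mulf_neq0 ?expf_neq0 //.
rewrite exprMn -exprM !mulrA; congr (_ * qpoch (_ / _) q _ * _ * _ * _ * _).
by rewrite exprD; ring.
Qed.

End Qpoch.

(** * The q-Saalschutz sum as an expansion *)

Section Expansions.
Variables (F : fieldType) (q : F).
Local Notation P x n := (qpoch x q n).

(** The q-Saalschutz sum with the denominator parameter D = e x y. *)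
Lemma qpoch_saalschutz (e x y : F) k :
  P q k != 0 -> P (e * x * y) k != 0 ->
  P (e * x) k * P (e * y) k =
  \sum_(j < k.+1) P q k / (P q j * P q (k - j)) * e ^+ j * P x j * P y j
    * (P (e * x * y) k / P (e * x * y) j) * P e (k - j).
Proof.
elim: k => [|k IH] Hq HD.
  by rewrite big_ord_recl big_ord0 !qpoch0 expr0 addr0 !mulr1 divr1 mul1r.
have Hq' := qpoch_neq0_le (leqnSn k) Hq.
have HD' := qpoch_neq0_le (leqnSn k) HD.
rewrite (qpochSr _ (e * x)) (qpochSr _ (e * y)) mulrACA IH // mulr_suml.
set D := e * x * y in HD HD' *.
have HDk j : (j < k.+1)%N -> 1 - D * q ^+ j != 0 by move/qpoch_neq0P: HD; apply.
have Hqk j : (j < k.+1)%N -> 1 - q * q ^+ j != 0 by move/qpoch_neq0P: Hq; apply.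
(* Put E = e q^d, X = x q^j, Y = y q^j with j + d = k. The new factor splits as (1 - E X)(1 - E Y) =
   (1 - E)(1 - E X Y) + E (1 - X)(1 - Y): the first part raises d and gives [g], the second raises j
   and gives [h]. The summand of the next level is [f]. *)
pose f j d := P q k.+1 / (P q j * P q d) * e ^+ j * P x j * P y j
  * (P D k.+1 / P D j) * P e d.
pose g j d := P q k / (P q j * P q d) * e ^+ j * P x j * P y j
  * (P D k / P D j) * P e d.+1 * (1 - D * q ^+ (k + j)).
pose h j d := P q k / (P q j * P q d) * e ^+ j.+1 * P x j.+1 * P y j.+1
  * (P D k / P D j) * P e d * q ^+ d.
pose t j d := P q k / (P q j * P q d) * e ^+ j * P x j * P y j
  * (P D k / P D j) * P e d * ((1 - e * x * q ^+ k) * (1 - e * y * q ^+ k)).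
transitivity (\sum_(j < k.+1) (g j (k - j)%N + h j (k - j)%N)).
  apply: (@ord_sumE _ t (fun j d => g j d + h j d)) => j d jd.
  rewrite /t /g /h !qpochSr -jd !exprD exprS /D; ring.
rewrite -(@sum_pascal _ f) //.
- rewrite /f /g !qpochSr !qpoch0 !expr0 ?addn0; field_nz.
- rewrite /f /h !qpochSr !qpoch0 !expr0 ?addn0; field_nz.
move=> j d jd; have [Hj Hd] : (j < k)%N /\ (d < k)%N.
  by rewrite -jd ltnS leq_addr ltnS leq_addl.
have nz z n : P z k.+1 != 0 -> (n < k)%N -> P z n != 0.
  by move=> H nk; apply: qpoch_neq0_le H; apply/ltnW/leqW.
have Hq1 := nz _ _ Hq Hj; have Hq2 := nz _ _ Hq Hd; have HD1 := nz _ _ HD Hj.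
have Hqj := Hqk j (leqW Hj); have Hqd := Hqk d (leqW Hd).
have HDj := HDk j (leqW Hj).
move: (HDk k (leqnn _)) (Hqk k (leqnn _)) => Ak Bk.
rewrite /f /g /h !qpochSr.
have ek : q ^+ k = q * q ^+ j * q ^+ d by rewrite -jd -addSn exprD exprS.
rewrite !exprD !exprS ek; rewrite ek in Ak Bk.
field_nz.
Qed.

(** * The very-well-poised 6phi5 sum as an expansion *)

(** Homogeneous q-shifted factorial, equal to x^n (y/x)_n for nonzero x. In this form the expansion
    coefficients have only differences of the type A q^i - B q^j and q-factorials in their
    denominators. *)
Definition hpoch (x y : F) (n : nat) : F := \prod_(t < n) (x - y * q ^+ t).

Lemma hpoch0 x y : hpoch x y 0 = 1.
Proof. by rewrite /hpoch big_ord0. Qed.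

Lemma hpochSr x y n : hpoch x y n.+1 = hpoch x y n * (x - y * q ^+ n).
Proof. by rewrite /hpoch big_ord_recr. Qed.

(** Every factor on the left except the first is q times a factor of [hpoch x y n]. *)
Lemma hpoch_mulq x y n :
  hpoch (x * q) y n.+1 = (x * q - y) * q ^+ n * hpoch x y n.
Proof.
elim: n => [|n IH]; first by rewrite hpochSr !hpoch0 expr0; ring.
by rewrite hpochSr IH (hpochSr x) !exprS; ring.
Qed.

Lemma hpoch_neq0 x y n :
  (forall t, (t < n)%N -> x - y * q ^+ t != 0) -> hpoch x y n != 0.
Proof. by move=> H; apply/prodf_neq0 => -[t tn] _; apply: H. Qed.

Lemma hpochE x y n : x != 0 -> hpoch x y n = x ^+ n * P (y / x) n.
Proof.
move=> x0; elim: n => [|n IH]; first by rewrite hpoch0 qpoch0 mulr1.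
by rewrite hpochSr qpochSr IH exprS; field_nz.
Qed.

(** The coefficient of (X A)_d (X B)_j in the expansion of (X v)_(j+d); it does not depend on X. *)
Definition vcoef (A B v : F) (j d : nat) : F :=
  P q (j + d) / (P q j * P q d) * q ^+ (j * d) * (hpoch A v j * hpoch B v d)
  / (hpoch (B * q ^+ j) A d * hpoch (A * q ^+ d) B j).

(** The terminating very-well-poised 6phi5 sum with alpha = q^-m B / A,
    b = X B and d = v / A. *)
Lemma qpoch_expand (A B v X : F) m : q != 0 ->
  P q m != 0 ->
  (forall i j, (i + j < m)%N -> A * q ^+ i - B * q ^+ j != 0) ->
  P (X * v) m =
  \sum_(j < m.+1) vcoef A B v j (m - j) * P (X * A) (m - j) * P (X * B) j.
Proof.
move=> q0; elim: m => [|m IH] Hq HAB.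
  rewrite big_ord_recl big_ord0 /vcoef !qpoch0 !hpoch0 expr0.
  by rewrite addr0 !mulr1 invr1 !mulr1.
have HAB' i j : (i + j < m)%N -> A * q ^+ i - B * q ^+ j != 0.
  by move=> ij; apply/HAB/leqW.
rewrite qpochSr IH //; last exact: qpoch_neq0_le Hq.
rewrite mulr_suml.
have Hqk j : (j < m.+1)%N -> 1 - q * q ^+ j != 0 by move/qpoch_neq0P: Hq; apply.
(* The weights satisfy lam + mu = 1 and lam A q^d + mu B q^j = v q^m. Hence the new factor 1 - X v
   q^m is lam (1 - X A q^d) + mu (1 - X B q^j), whatever X is. *)
pose lam j d := (v * q ^+ m - B * q ^+ j) / (A * q ^+ d - B * q ^+ j).
pose mu j d := (A * q ^+ d - v * q ^+ m) / (A * q ^+ d - B * q ^+ j).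
pose f j d := vcoef A B v j d * P (X * A) d * P (X * B) j.
pose g j d := vcoef A B v j d * lam j d * P (X * A) d.+1 * P (X * B) j.
pose h j d := vcoef A B v j d * mu j d * P (X * A) d * P (X * B) j.+1.
pose t j d := vcoef A B v j d * P (X * A) d * P (X * B) j * (1 - X * v * q ^+ m).
transitivity (\sum_(j < m.+1) (g j (m - j)%N + h j (m - j)%N)).
  apply: (@ord_sumE _ t (fun j d => g j d + h j d)) => j d jd.
  have H : A * q ^+ d - B * q ^+ j != 0 by apply: HAB; rewrite addnC jd.
  by rewrite /t /g /h /lam /mu !qpochSr; field_nz.
have HG j d : (j + d <= m.+1)%N -> hpoch (B * q ^+ j) A d != 0.
  move=> jd; apply: hpoch_neq0 => k kd; rewrite -oppr_eq0 opprB.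
  by apply: HAB; apply: leq_trans jd; rewrite addnC ltn_add2l.
have HG' j d : (j + d <= m.+1)%N -> hpoch (A * q ^+ d) B j != 0.
  move=> jd; apply: hpoch_neq0 => k kd.
  by apply: HAB; apply: leq_trans jd; rewrite addnC ltn_add2r.
have nz j : (j <= m.+1)%N -> P q j != 0.
  by move=> H; apply: qpoch_neq0_le Hq.
rewrite -(@sum_pascal _ f) //.
- have H : A * q ^+ m - B != 0 by rewrite -[B]mulr1 -(expr0 q) HAB ?addn0.
  have H' : B - A * q ^+ m != 0 by rewrite -oppr_eq0 opprB.
  have := HG 0%N m (leqnSn m); have := nz m (leqnSn m); have := Hqk m (leqnn _).
  rewrite /f /g /vcoef /lam !hpochSr !hpoch0 !mul0n !add0n !qpochSr !qpoch0.
  rewrite !expr0 !mulr1 => *; field_nz.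
- have H : A - B * q ^+ m != 0 by rewrite -[A]mulr1 -(expr0 q) HAB.
  have := HG' m 0%N; rewrite addn0 => /(_ (leqnSn m)); rewrite expr0 mulr1.
  have := nz m (leqnSn m); have := Hqk m (leqnn _).
  rewrite /f /h /vcoef /mu !hpochSr !hpoch0 !muln0 !addn0 !qpochSr !qpoch0.
  rewrite !expr0 !mulr1 => *; field_nz.
move=> j d jd; rewrite /f /g /h /vcoef /lam /mu.
have [Hj Hd] : (j < m)%N /\ (d < m)%N by rewrite -jd ltnS leq_addr ltnS leq_addl.
have Hjd : (j + d <= m.+1)%N by rewrite -jd; apply/leqW/leqW.
have H1 := HG j d Hjd; have H2 := HG' j d Hjd.
have Hq1 := nz j (leqW (ltnW Hj)); have Hq2 := nz d (leqW (ltnW Hd)).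
have Hqj := Hqk j (leqW Hj); have Hqd := Hqk d (leqW Hd).
have X1 : A * q ^+ d - B * (q * q ^+ j) != 0.
  by rewrite -exprS; apply: HAB; rewrite addnS addnC jd.
have X2 : A * (q * q ^+ d) - B * q ^+ j != 0.
  by rewrite -exprS; apply: HAB; rewrite addSn addnC jd.
have X1' : B * q ^+ j * q - A * q ^+ d != 0.
  by rewrite -mulrA [_ * q]mulrC -oppr_eq0 opprB.
(* [G1] and [G2] bring the denominators of the neighbouring coefficients back to those at (j, d), so
   that a rational identity remains. *)
have G1 : hpoch (B * q ^+ j.+1) A d =
    (B * q ^+ j * q - A) * q ^+ d * hpoch (B * q ^+ j) A d
    / (B * q ^+ j * q - A * q ^+ d).
  apply: (mulIf X1'); rewrite divfK // -hpoch_mulq hpochSr exprSr mulrA //.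
have X2' : A * q ^+ d * q - B * q ^+ j != 0.
  by rewrite -mulrA [_ * q]mulrC.
have G2 : hpoch (A * q ^+ d.+1) B j =
    (A * q ^+ d * q - B) * q ^+ j * hpoch (A * q ^+ d) B j
    / (A * q ^+ d * q - B * q ^+ j).
  apply: (mulIf X2'); rewrite divfK // -hpoch_mulq hpochSr exprSr mulrA //.
have Y1 : B * q ^+ j * q - A != 0.
  by rewrite -mulrA -exprSr -[A]mulr1 -(expr0 q) -oppr_eq0 opprB HAB.
have Y2 : A * q ^+ d * q - B != 0.
  by rewrite -mulrA -exprSr -[B]mulr1 -(expr0 q) HAB // addn0.
have [qj qd] : q ^+ j != 0 /\ q ^+ d != 0 by rewrite !expf_neq0.
have em : q ^+ m = q * q ^+ j * q ^+ d by rewrite -jd -addSn exprD exprS.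
have e1 : q ^+ (j.+1 * d) = q ^+ (j * d) * q ^+ d by rewrite mulSn exprD mulrC.
have e2 : q ^+ (j * d.+1) = q ^+ (j * d) * q ^+ j by rewrite mulnS exprD mulrC.
have e3 : q ^+ (j.+1 * d.+1) = q ^+ (j * d) * q ^+ j * q ^+ d * q.
  by rewrite mulSn mulnS !exprD exprS; ring.
have Hqm := Hqk m (leqnn _).
rewrite !hpochSr G1 G2 e1 e2 e3 !addSn !addnS jd !(qpochSr _ q) em !exprS.
rewrite em in Hqm.
have x00 : B * q ^+ j - A * q ^+ d != 0.
  by rewrite -oppr_eq0 opprB; apply: HAB'; rewrite addnC -jd.
have x01 : A * q ^+ d - B * q ^+ j != 0 by rewrite -oppr_eq0 opprB.
move: (P (X * A) d.+1) (P (X * B) j.+1) (q ^+ (j * d)) => U V W.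
move: H1 H2 Hq1 Hq2 Hqj Hqd X1 X2 X1' X2' Y1 Y2 qj qd Hqm q0 x00 x01.
clear.
move: (hpoch _ _ _) (hpoch _ _ _) (hpoch _ _ _) (hpoch _ _ _).
move: (P q j) (P q d) (P q m) (q ^+ j) (q ^+ d).
move=> *; field_nz.
Qed.

(** * The q-Watson sum as an expansion *)

Local Notation P2 x n := (qpoch x (q ^+ 2) n).

(** With N = k + d this is the q-Watson coefficient (q^-N, -q^-N; q)_k q^k / (q, q^(-2N); q)_k
    multiplied by (q; q^2)_N, with the negative powers of q cleared. *)
Definition wcoef (k d : nat) : F :=
  q ^+ 'C(k.+1, 2) * P2 q d * P q (d.*2 + k) / (P q k * P q d.*2).

(** Induction on N by the same splitting of (1 - E X)(1 - E Y) as for q-Saalschutz, now with E =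
    q^(2d+k+1), X = A q^k, Y = B q^k, where k + d = N. *)
Lemma q_watson_poly (A B : F) N :
  P q N.*2 != 0 -> P2 (q * A * B) N != 0 ->
  P2 (q * A) N * P2 (q * B) N =
  \sum_(k < N.+1) wcoef k (N - k) * P A k * P B k
    * (P2 (q * A * B) N / P2 (q * A * B) k).
Proof.
elim: N => [|N IH] Hq HD.
  by rewrite big_ord_recl big_ord0 /wcoef !qpoch0 expr0 addr0 !mulr1 invr1 !mulr1.
have Hq' : P q N.*2 != 0 by apply: qpoch_neq0_le Hq; rewrite leq_double.
have HD' := qpoch_neq0_le (leqnSn N) HD.
rewrite (qpochSr _ (q * A)) (qpochSr _ (q * B)) mulrACA IH // mulr_suml.
have [Q EQ] : exists Q, Q = q ^+ 2 by exists (q ^+ 2).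
have sq k : Q ^+ k = q ^+ k * q ^+ k by rewrite EQ -expr2 -!exprM mulnC.
rewrite -EQ in HD HD' *.
set D := q * A * B in HD HD' *.
have HDk j : (j < N.+1)%N -> 1 - D * Q ^+ j != 0.
  by move/qpoch_neq0P: HD; apply.
have Hqk j : (j < N.*2.+2)%N -> 1 - q * q ^+ j != 0.
  by move/qpoch_neq0P: Hq; apply.
pose f k d := wcoef k d * P A k * P B k * (qpoch D Q N.+1 / qpoch D Q k).
pose g k d := wcoef k d * P A k * P B k * (qpoch D Q N / qpoch D Q k)
  * ((1 - q ^+ (d.*2 + k).+1) * (1 - D * q ^+ (N.*2 + k))).
pose h k d := wcoef k d * P A k.+1 * P B k.+1 * (qpoch D Q N / qpoch D Q k)
  * q ^+ (d.*2 + k).+1.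
pose t k d := wcoef k d * P A k * P B k * (qpoch D Q N / qpoch D Q k)
  * ((1 - q * A * Q ^+ N) * (1 - q * B * Q ^+ N)).
have dq k : q ^+ k.*2 = q ^+ k * q ^+ k by rewrite -addnn exprD.
transitivity (\sum_(j < N.+1) (g j (N - j)%N + h j (N - j)%N)).
  apply: (@ord_sumE _ t (fun j d => g j d + h j d)) => k d kd.
  by rewrite /t /g /h !qpochSr !sq -kd !exprS !exprD !dq !exprD /D; ring.
rewrite -(@sum_pascal _ f) //.
- have := Hqk N.*2.+1 (leqnn _); have := Hqk N.*2 (leqW (leqnn _)).
  have := HDk _ (leqnn _).
  rewrite /f /g /wcoef -EQ !doubleS !addn0 !qpochSr !qpoch0 !expr0.
  by rewrite !sq !exprS !dq => *; field_nz.
- have le1 : (N.+1 < N.*2.+2)%N.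
    by rewrite ltnS -addnn ltnS leq_addr.
  have := Hqk N (ltnW le1); have := HDk _ (leqnn _).
  have : P q N != 0 by by apply: qpoch_neq0_le Hq; apply: leqW; apply: ltnW.
  rewrite /f /h /wcoef -EQ !double0 !add0n !qpochSr !qpoch0.
  rewrite (binS N.+1) bin1 exprD !sq !exprS => *; field_nz.
move=> k d kd; have [Hj Hd] : (k < N)%N /\ (d < N)%N.
  by rewrite -kd ltnS leq_addr ltnS leq_addl.
have nzq n : (n <= N.*2.+2)%N -> P q n != 0.
  by move=> nk; apply: qpoch_neq0_le Hq.
have nzD n : (n <= N.+1)%N -> qpoch D Q n != 0.
  by move=> nk; apply: qpoch_neq0_le HD.
have E : N.*2 = (k.*2 + d.*2).+2 by rewrite -kd doubleS doubleD.
have le1 : (k < N.*2.+2)%N by clear -E; lia.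
have le2 : (d.*2.+1 < N.*2.+2)%N by clear -E; lia.
have le3 : (d.*2 + k < N.*2)%N by clear -E; lia.
have Z1 := nzq _ (ltnW le1); have Z2 := nzq _ (ltnW (ltnW le2)).
have Z3 := nzq _ (ltnW (leqW (leqW le3))).
have Z4 := nzD k (leqW (ltnW Hj)).
have Z5 := HDk k (leqW Hj); have Z6 := Hqk k le1.
have Z7 := Hqk _ (ltnW le2); have Z8 := Hqk _ le2.
have Z9 := HD'.
have eN : q ^+ N = q * q ^+ k * q ^+ d by rewrite -kd exprS exprD mulrA.
(* [x] is q^(2d+k+1). The three ratios [W1], [W2], [W3] express the neighbouring coefficients
   through [wcoef k d]. *)
pose x := q * (q ^+ d * q ^+ d) * q ^+ k.
have W1 : wcoef k.+1 d.+1 = wcoef k d * (q * q ^+ k * ((1 - x) * (1 - q * x)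
    * (1 - q * q * x)) / ((1 - q * q ^+ k) * (1 - q * q ^+ d.*2.+1))).
  rewrite /wcoef -EQ doubleS !addSn !addnS !qpochSr (binS k.+1) bin1 /x.
  rewrite !exprS !exprD !sq ?exprS !dq; rewrite ?exprS !dq in Z7 Z8; field_nz.
have W2 : wcoef k.+1 d = wcoef k d * (q * q ^+ k * (1 - x) / (1 - q * q ^+ k)).
  rewrite /wcoef -EQ !addnS !qpochSr (binS k.+1) bin1 /x.
  rewrite !exprD !exprS ?dq; field_nz.
have W3 : wcoef k d.+1 = wcoef k d * ((1 - x) * (1 - q * x)
    / (1 - q * q ^+ d.*2.+1)).
  rewrite /wcoef -EQ doubleS !addSn !qpochSr /x.
  rewrite !exprS !exprD !sq ?exprS !dq; rewrite ?exprS !dq in Z7 Z8; field_nz.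
rewrite /f /g /h W1 W2 W3 !addSn !addnS !qpochSr !exprS !exprD ?exprS !dq !sq eN.
rewrite ?exprS !sq !dq in Z5 Z8 *.
rewrite /x.
(* What remains of the recurrence, with K standing for q^k and e for q^d, is a rational identity in
   independent variables. *)
have step (c p p1 p2 p3 K e : F) : p1 != 0 -> 1 - D * (K * K) != 0 ->
    1 - q * K != 0 -> 1 - q * (q * (e * e)) != 0 ->
    c * (q * K * ((1 - q * (e * e) * K) * (1 - q * (q * (e * e) * K))
        * (1 - q * q * (q * (e * e) * K)))
      / ((1 - q * K) * (1 - q * (q * (e * e)))))
      * (p2 * (1 - A * K)) * (p3 * (1 - B * K))
      * (p * (1 - D * (q * K * e * (q * K * e))) / (p1 * (1 - D * (K * K)))) =
    c * (q * K * (1 - q * (e * e) * K) / (1 - q * K))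
      * (p2 * (1 - A * K)) * (p3 * (1 - B * K))
      * (p / (p1 * (1 - D * (K * K))))
      * ((1 - q * (q * (e * e * K)))
         * (1 - D * (q * (q * K * e * (q * K * e) * K))))
    + c * ((1 - q * (e * e) * K) * (1 - q * (q * (e * e) * K))
        / (1 - q * (q * (e * e))))
      * (p2 * (1 - A * K)) * (p3 * (1 - B * K)) * (p / p1)
      * (q * (q * (q * (e * e * K)))).
  by move=> *; field_nz.
exact: step.
Qed.

(** * Sears' transformation *)

(** The classical form of q-Saalschutz. It is [qpoch_saalschutz] at e' = ga / (al e): reversing
    (q)_(N-r) and (e')_(N-r) produces (q^-N)_r and, by the balancing condition, (de)_r. *)
Lemma qpoch_saalschutz_sum (al e ga de : F) N :
  q != 0 -> al != 0 -> e != 0 -> ga != 0 -> q ^+ N * ga * de = q * al * e ->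
  P q N != 0 -> P ga N != 0 -> P de N != 0 ->
  \sum_(r < N.+1) P (q ^+ N)^-1 r * P al r * P e r
     / (P q r * P ga r * P de r) * q ^+ r =
  P (ga / al) N * P (ga / e) N / (P ga N * P (ga / (al * e)) N).
Proof.
move=> q0 al0 e0 ga0 bal Hq Hga Hde.
have QN := expf_neq0 N q0.
set e' := ga / (al * e).
have e'0 : e' != 0 by rewrite !mulf_neq0 ?invr_neq0 ?mulf_neq0.
have Ede : de = q / (q ^+ N * e').
  apply: (mulfI QN); apply: (mulfI ga0); rewrite mulrCA mulrA bal /e'; field_nz.
have He' : P e' N != 0.
  rewrite (qpoch_rev _ q0 e'0) -Ede !mulf_neq0 ?expf_neq0 ?oppr_eq0 ?oner_neq0 //.
have -> : ga / al = e' * e by rewrite /e'; field_nz.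
have -> : ga / e = e' * al by rewrite /e'; field_nz.
have Ega : e' * al * e = ga by rewrite /e'; field_nz.
have := @qpoch_saalschutz e' al e N Hq; rewrite Ega => /(_ Hga).
rewrite [P (e' * e) N * _]mulrC => ->.
rewrite mulr_suml; apply: eq_bigr => -[r /= rN] _.
have [d dN] : exists d, N = (d + r)%N by exists (N - r)%N; rewrite subnK.
have Hr : (r <= N)%N by [].
have Hd : (d <= N)%N by rewrite dN leq_addr.
have := qpoch_rev_split d r q0 q0; have := qpoch_rev_split d r q0 e'0.
rewrite -dN -Ede.
have -> : q / (q ^+ N * q) = (q ^+ N)^-1 by field_nz.
have -> : (N - r = d)%N by rewrite dN addnK.
move=> R1 R2.
have h1 := qpoch_neq0_le Hr Hq; have h2 := qpoch_neq0_le Hd Hq.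
have h3 := qpoch_neq0_le Hr Hga; have h4 := qpoch_neq0_le Hr Hde.
have h5 := qpoch_neq0_le Hd He'; have h6 : e' ^+ r != 0 by rewrite expf_neq0.
have h7 : q ^+ (d * r) != 0 by rewrite expf_neq0.
have h8 : q ^+ 'C(r, 2) != 0 by rewrite expf_neq0.
have h9 : (-1) ^+ r != 0 :> F by rewrite expf_neq0 // oppr_eq0 oner_neq0.
have h10 : q ^+ r != 0 by rewrite expf_neq0.
rewrite R1 {1}R2; field_nz.
Qed.

Lemma sum_triangle (V : nmodType) (f : nat -> nat -> V) n :
  \sum_(k < n.+1) \sum_(j < k.+1) f j (k - j)%N =
  \sum_(j < n.+1) \sum_(r < (n - j).+1) f j r.
Proof.
elim: n => [|n IH]; first by rewrite !big_ord1.
rewrite big_ord_recr IH /= [RHS]big_ord_recr /= subnn [in RHS]big_ord1.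
rewrite [X in _ + X]big_ord_recr /= subnn addrA; congr (_ + _).
rewrite -big_split /=; apply: eq_bigr => -[j /= jn] _.
by rewrite subSn // [in RHS]big_ord_recr.
Qed.

(** Sears' transformation.  The target series is kept in reversed order and
    with (E/A, G/A)_k in the numerator, because in the application E/A is a
    parameter for which (E/A)_n may vanish. *)
Lemma sears_poly (A x y e E G : F) n : q != 0 ->
  A != 0 -> e != 0 -> E != 0 -> G != 0 -> q ^+ n * E * G = q * A * e ->
  P q n != 0 -> P (e * x * y) n != 0 -> P E n != 0 -> P G n != 0 ->
  P E n * P G n * \sum_(k < n.+1) P (q ^+ n)^-1 k * P A k
    * P (e * x) k * P (e * y) k
    / (P q k * P (e * x * y) k * P E k * P G k) * q ^+ k =
  \sum_(k < n.+1) P (q ^+ n)^-1 (n - k) * P A (n - k) * P x (n - k) * P y (n - k)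
    / (P q (n - k) * P (e * x * y) (n - k))
    * (P (E / A) k * P (G / A) k * A ^+ k)
    * ((e * q) ^+ (n - k) * q ^+ (k * (n - k))).
Proof.
move=> q0 A0 e0 E0 G0 bal Hq HD HE HG.
set D := e * x * y in HD *.
have nz z k : P z n != 0 -> (k <= n)%N -> P z k != 0.
  by move=> H kn; apply: qpoch_neq0_le H.
(* The product (e x)_k (e y)_k is expanded by q-Saalschutz with k = j + r; [f] is the resulting
   double summand. After exchanging the sums, the sum over r is again of q-Saalschutz type. *)
pose f j r := P (q ^+ n)^-1 (j + r) * P A (j + r) / (P E (j + r) * P G (j + r))
  * q ^+ (j + r) * (e ^+ j * P x j * P y j * P e r / (P q j * P q r * P D j)).
transitivity (P E n * P G n * \sum_(k < n.+1) \sum_(j < k.+1) f j (k - j)%N).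
  congr (_ * _); apply: eq_bigr => -[k /= kn] _.
  have HDk := nz _ k HD kn; have Hqk := nz _ k Hq kn.
  have HEk := nz _ k HE kn; have HGk := nz _ k HG kn.
  have := qpoch_saalschutz Hqk HDk; rewrite -/D => S.
  transitivity (P (q ^+ n)^-1 k * P A k / (P E k * P G k) * q ^+ k / (P q k * P D k)
     * (P (e * x) k * P (e * y) k)); first by field_nz.
  rewrite S mulr_sumr; apply: eq_bigr => -[j /= jk] _.
  have jn : (j <= n)%N by exact: (leq_trans jk kn).
  have kjn : (k - j <= n)%N by apply: (@leq_trans k); rewrite ?leq_subr.
  have HDj := nz _ j HD jn; have Hqj := nz _ j Hq jn.
  have Hqkj := nz _ _ Hq kjn.
  rewrite /f subnKC //; field_nz.
(* The outer index becomes k = n - j, so that the inner sum has length k and parameters A q^j, e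
   over E q^j, G q^j. This is why the target series appears in reversed order. *)
rewrite sum_triangle (reindex_inj rev_ord_inj) /= mulr_sumr.
apply: eq_bigr => -[k /= kn] _.
rewrite ltnS in kn; rewrite subSS (subKn kn).
have [j nj] : exists j, n = (j + k)%N by exists (n - k)%N; rewrite subnK.
have -> : (n - k = j)%N by rewrite nj addnK.
have jn : (j <= n)%N by rewrite nj leq_addr.
have [Qj Qk] : q ^+ j != 0 /\ q ^+ k != 0 by rewrite !expf_neq0.
have Hqj := nz _ j Hq jn; have HDj := nz _ j HD jn.
have HEj := nz _ j HE jn; have HGj := nz _ j HG jn.
have HEk : P (E * q ^+ j) k != 0.
  by move: HE; rewrite nj qpochD mulf_eq0 negb_or => /andP[].
have HGk : P (G * q ^+ j) k != 0.
  by move: HG; rewrite nj qpochD mulf_eq0 negb_or => /andP[].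
have bal' : q ^+ k * (E * q ^+ j) * (G * q ^+ j) = q * (A * q ^+ j) * e.
  rewrite nj exprD in bal.
  by transitivity (q * A * e * q ^+ j); [rewrite -bal; ring | ring].
have := qpoch_saalschutz_sum q0 (mulf_neq0 A0 Qj) e0 (mulf_neq0 E0 Qj) bal'
  (nz _ k Hq kn) HEk HGk.
set W := \sum_(r < k.+1) _ => S.
pose c := P (q ^+ n)^-1 j * P A j / (P E j * P G j) * q ^+ j
  * (e ^+ j * P x j * P y j / (P q j * P D j)).
have -> : \sum_(r < k.+1) f j r = c * W.
  rewrite /W mulr_sumr; apply: eq_bigr => -[r /= rk] _.
  rewrite /f /c !qpochD.
  have rkk : (r <= k)%N by [].
  have h1 := qpoch_neq0_le rkk HEk; have h2 := qpoch_neq0_le rkk HGk.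
  have h3 := nz _ r Hq (leq_trans rkk kn).
  have -> : (q ^+ n)^-1 * q ^+ j = (q ^+ k)^-1 by rewrite nj exprD; field_nz.
  by rewrite exprD; field_nz.
have := @qpoch_rev _ q (G * q ^+ j) k q0 (mulf_neq0 G0 Qj).
have y0 : E * q ^+ j / e != 0 by rewrite !mulf_neq0 ?invr_neq0.
have := @qpoch_rev _ q (E * q ^+ j / e) k q0 y0.
have -> : q / (q ^+ k * (E * q ^+ j / e)) = G / A.
  have B1 : q = q ^+ n * E * G / (A * e) by rewrite bal; field_nz.
  rewrite {1}B1 nj exprD; field_nz.
have -> : q / (q ^+ k * (G * q ^+ j)) = E * q ^+ j / (A * q ^+ j * e).
  have B1 : q = q ^+ n * E * G / (A * e) by rewrite bal; field_nz.
  rewrite {1}B1 nj exprD; field_nz.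
move=> R1 R2.
rewrite S R1.
have -> : E * q ^+ j / (A * q ^+ j) = E / A by field_nz.
have R3 : P (E * q ^+ j / (A * q ^+ j * e)) k != 0.
  by move: HGk; rewrite R2 mulf_eq0 negb_or => /andP[].
have -> : P E n = P E j * P (E * q ^+ j) k by rewrite nj qpochD.
have -> : P G n = P G j * P (G * q ^+ j) k by rewrite nj qpochD.
rewrite R2.
have K2 : q ^+ 'C(k, 2) * q ^+ 'C(k, 2) * q ^+ k = q ^+ (k * k).
  by rewrite -!exprD bin2_sq.
have K1 : (-1) ^+ k * (-1) ^+ k = 1 :> F by rewrite -exprMn mulrNN mulr1 expr1n.
(* By the balancing condition the monomials left by the two reversals multiply to A^k q^(kj). *)
have K3 : ((-1) ^+ k * (G * q ^+ j) ^+ k * q ^+ 'C(k, 2))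
   * ((-1) ^+ k * (E * q ^+ j / e) ^+ k * q ^+ 'C(k, 2)) = A ^+ k * q ^+ (k * j).
  apply: (mulIf Qk).
  transitivity (((-1) ^+ k * (-1) ^+ k) * ((G * q ^+ j) ^+ k * (E * q ^+ j / e) ^+ k)
    * (q ^+ 'C(k, 2) * q ^+ 'C(k, 2) * q ^+ k)); first by ring.
  rewrite K1 K2 mul1r -exprMn exprM -exprMn.
  have -> : G * q ^+ j * (E * q ^+ j / e) * q ^+ k = A * q ^+ j * q.
    apply: (mulIf e0); transitivity (q ^+ k * (E * q ^+ j) * (G * q ^+ j)).
      by field_nz.
    by rewrite bal'; ring.
  by rewrite !exprMn exprM exprAC -!exprM mulnC; ring.
move: K3; set M1 := (_ * q ^+ 'C(k, 2)); set M2 := (_ * q ^+ 'C(k, 2)) => K3.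
transitivity (P (q ^+ n)^-1 j * P A j * P x j * P y j / (P q j * P D j) *
  (P (E / A) k * P (G / A) k) * (e ^+ j * q ^+ j) * (M1 * M2)).
  by rewrite /c; field_nz.
by rewrite K3 exprMn; ring.
Qed.

(** [sears_poly] is applied to the series on the right, with E = s A and G = t A. Its target, in
    reversed order, agrees term by term with the series on the left once each factorial of length n
    - k is rewritten as a quotient of factorials of lengths n and k. *)
Lemma sears_rev (w x y z s t : F) n :
  let A := q / (q ^+ n * z) in
  q != 0 -> w != 0 -> x != 0 -> y != 0 -> z != 0 -> s != 0 -> t != 0 ->
  q ^+ n * (x * y * z) = q * w * s * t ->
  P q n != 0 -> P w n != 0 -> P x n != 0 -> P y n != 0 -> P z n != 0 ->
  P (s * A) n != 0 -> P (t * A) n != 0 ->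
  \sum_(k < n.+1) P (q ^+ n)^-1 k * P w k * P s k * P t k
    / (P q k * P x k * P y k * P z k) * q ^+ k =
  P (s * A) n * P (t * A) n * P w n / (P x n * P y n * P A n) *
  \sum_(k < n.+1) P (q ^+ n)^-1 k * P A k * P (x / w) k * P (y / w) k
    / (P q k * P (q / (q ^+ n * w)) k * P (s * A) k * P (t * A) k) * q ^+ k.
Proof.
move=> A q0 w0 x0 y0 z0 s0 t0 bal Hq Hw Hx Hy Hz HE HG.
have Qn : q ^+ n != 0 by rewrite expf_neq0.
have A0 : A != 0 by rewrite !mulf_neq0 ?invr_neq0 ?mulf_neq0.
pose e := q ^+ n * (x * y) / (q * w).
have e0 : e != 0 by rewrite !mulf_neq0 ?invr_neq0 ?mulf_neq0.
pose x' := q / (q ^+ n * x); pose y' := q / (q ^+ n * y).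
pose D := q / (q ^+ n * w).
have eD : e * x' * y' = D by rewrite /e /x' /y' /D; field_nz.
have ex : e * x' = y / w by rewrite /e /x'; field_nz.
have ey : e * y' = x / w by rewrite /e /y'; field_nz.
have bal' : q ^+ n * (s * A) * (t * A) = q * A * e.
  transitivity (q * w * s * t * (A * q / (q * w * z))); first by rewrite /A; field_nz.
  by rewrite -bal /e; field_nz.
have rv u : u != 0 -> P u n != 0 -> P (q / (q ^+ n * u)) n != 0.
  by move=> u0; rewrite (qpoch_rev _ q0 u0) mulf_eq0 negb_or => /andP[].
have HD : P (e * x' * y') n != 0 by rewrite eD; apply: rv.
have HA : P A n != 0 by apply: rv.
have := sears_poly q0 A0 e0 (mulf_neq0 s0 A0) (mulf_neq0 t0 A0) bal' Hq HD HE HG.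
rewrite eD ex ey !mulfK // -/D.
set S := \sum_(k < n.+1) _ => HS.
have -> : \sum_(k < n.+1) P (q ^+ n)^-1 k * P A k * P (x / w) k * P (y / w) k
    / (P q k * P D k * P (s * A) k * P (t * A) k) * q ^+ k = S.
  by apply: eq_bigr => k _; rewrite -!mulrA [P (x / w) _ * _]mulrCA.
transitivity (P w n / (P x n * P y n * P A n) * (P (s * A) n * P (t * A) n * S));
  last by field_nz.
rewrite HS mulr_sumr; apply: eq_bigr => -[k /= kn] _; rewrite ltnS in kn.
have [j nj] : exists j, n = (k + j)%N by exists (n - k)%N; rewrite subnKC.
have -> : (n - k = j)%N by rewrite nj addKn.
have nz u : P u n != 0 -> P u k != 0 by move=> H; apply: qpoch_neq0_le H.
have [Qj Qk] : q ^+ j != 0 /\ q ^+ k != 0 by rewrite !expf_neq0.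
have qn0 : (q ^+ n)^-1 != 0 by rewrite invr_neq0.
(* [M u] is the monomial produced by reversing the last j factors of (u)_n; [key] below says that
   all these monomials and the powers of A and e reduce to q^k. *)
pose M (u : F) : F := (-1) ^+ j * u ^+ j * q ^+ (k * j) * q ^+ 'C(j, 2).
have M0 u : u != 0 -> M u != 0.
  by move=> u0; rewrite !mulf_neq0 ?expf_neq0 ?oppr_eq0 ?oner_neq0.
have sp u : u != 0 -> P u n = P u k * P (q / (q ^+ n * u)) j * M u.
  by move=> u0; rewrite {1}nj qpoch_rev_split // -nj.
have sq := sp _ q0; have sqn := sp _ qn0; have sx := sp _ x0.
have sy := sp _ y0; have sz := sp _ z0; have sw := sp _ w0.
have E1 : q / (q ^+ n * q) = (q ^+ n)^-1 by field_nz.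
have E2 : q / (q ^+ n * (q ^+ n)^-1) = q by field_nz.
have Hqn : P (q ^+ n)^-1 n != 0 by rewrite -E1; apply: rv.
rewrite E1 in sq; rewrite E2 in sqn; rewrite -/A in sz.
rewrite -/x' in sx; rewrite -/y' in sy; rewrite -/D in sw.
have rz : P z n = P A n * ((-1) ^+ n * z ^+ n * q ^+ 'C(n, 2)) by apply: qpoch_rev.
have rq : P q n = P (q ^+ n)^-1 n * ((-1) ^+ n * q ^+ n * q ^+ 'C(n, 2)).
  by rewrite -E1; apply: qpoch_rev.
have key : M (q ^+ n)^-1 * M w / (M q * M x * M y * M z)
    * (A ^+ k * ((e * q) ^+ j * q ^+ (k * j)))
    * (((-1) ^+ n * z ^+ n * q ^+ 'C(n, 2)) * ((-1) ^+ n * q ^+ n * q ^+ 'C(n, 2)))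
  = q ^+ k.
  have cn : q ^+ 'C(n, 2) * q ^+ 'C(n, 2) * q ^+ k =
      q ^+ (k * k) * q ^+ (k * j) * q ^+ (k * j) * (q ^+ 'C(j, 2) * q ^+ 'C(j, 2)).
    apply: (mulIf Qj); rewrite -!exprD -addnA -addnA -nj.
    have := bin2_sq n; have := bin2_sq j; clear -nj => Bj Bn; congr (_ ^+ _); nia.
  have eqj : (e * q) ^+ j = (q ^+ n) ^+ j * x ^+ j * y ^+ j / w ^+ j.
    by rewrite -!exprMn -exprVn -exprMn; congr (_ ^+ _); rewrite /e; field_nz.
  have Ak : A ^+ k = q ^+ k / (q ^+ (k * k) * q ^+ (k * j) * z ^+ k).
    rewrite /A exprMn exprVn exprMn -exprM -exprD -mulnDr -nj mulnC //.
  have sg i : (-1) ^+ i * (-1) ^+ i = 1 :> F by rewrite -exprMn mulrNN mulr1 expr1n.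
  have [xj yj] : x ^+ j != 0 /\ y ^+ j != 0 by rewrite !expf_neq0.
  have [zj wj] : z ^+ j != 0 /\ w ^+ j != 0 by rewrite !expf_neq0.
  have [zk Nj] : z ^+ k != 0 /\ (q ^+ n) ^+ j != 0 by rewrite !expf_neq0.
  have [akk bkj] : q ^+ (k * k) != 0 /\ q ^+ (k * j) != 0 by rewrite !expf_neq0.
  have cj : q ^+ 'C(j, 2) != 0 by rewrite expf_neq0.
  have sj : (-1) ^+ j != 0 :> F by rewrite expf_neq0 // oppr_eq0 oner_neq0.
  transitivity ((q ^+ 'C(n, 2) * q ^+ 'C(n, 2) * q ^+ k) * q ^+ k
     / (q ^+ (k * k) * q ^+ (k * j) * q ^+ (k * j) * (q ^+ 'C(j, 2) * q ^+ 'C(j, 2)))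
     * ((-1) ^+ n * (-1) ^+ n) / ((-1) ^+ j * (-1) ^+ j)).
    have zn : z ^+ n = z ^+ k * z ^+ j by rewrite nj exprD.
    have qn : q ^+ n = q ^+ k * q ^+ j by rewrite nj exprD.
    rewrite /M eqj Ak zn exprVn; set N1 := (q ^+ n) ^+ j in Nj *; rewrite qn.
    by field_nz.
  by rewrite cn !sg; field_nz.
rewrite -key.
have nzs u v : P u n != 0 -> P u n = P u k * P v j * M u -> P v j != 0.
  by move=> H E0; move: H; rewrite E0 mulf_eq0 mulf_eq0 !negb_or => /andP[/andP[]].
have j1 := nzs _ _ Hq sq; have j2 := nzs _ _ Hqn sqn; have j3 := nzs _ _ Hx sx.
have j4 := nzs _ _ Hy sy; have j5 := nzs _ _ Hz sz; have j6 := nzs _ _ Hw sw.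
have zn0 : (-1) ^+ n * z ^+ n * q ^+ 'C(n, 2) != 0.
  by rewrite !mulf_neq0 ?expf_neq0 ?oppr_eq0 ?oner_neq0.
have -> : (-1) ^+ n * z ^+ n * q ^+ 'C(n, 2) = P z n / P A n.
  by rewrite rz; field_nz.
have -> : (-1) ^+ n * q ^+ n * q ^+ 'C(n, 2) = P q n / P (q ^+ n)^-1 n.
  by rewrite [P q n]rq; field_nz.
have m1 := M0 _ q0; have m2 := M0 _ qn0; have m3 := M0 _ x0.
have m4 := M0 _ y0; have m5 := M0 _ z0; have m6 := M0 _ w0.
have k1 := nz _ Hq; have k2 := nz _ Hqn; have k3 := nz _ Hx.
have k4 := nz _ Hy; have k5 := nz _ Hz; have k6 := nz _ Hw.
rewrite sq sqn sx sy sz sw.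
clear -m1 m2 m3 m4 m5 m6 k1 k2 k3 k4 k5 k6 j1 j2 j3 j4 j5 j6 HA Qk Qj.
move: (M q) (M (q ^+ n)^-1) (M x) (M y) (M z) (M w) m1 m2 m3 m4 m5 m6.
by move=> *; field_nz.
Qed.

(** * The terminating q-Watson sum *)

Lemma qpoch_sqr (u : F) n : P u n * P (- u) n = P2 (u ^+ 2) n.
Proof.
elim: n => [|n IH]; first by rewrite !qpoch0 mulr1.
rewrite !qpochSr -IH -exprM mulnC exprM; ring.
Qed.

Lemma qpoch_even_odd n : P q n.*2 = P2 q n * P2 (q ^+ 2) n.
Proof.
elim: n => [|n IH]; first by rewrite !qpoch0 mulr1.
have -> : P q n.+1.*2 = P q n.*2 * (1 - q * q ^+ n.*2) * (1 - q * (q * q ^+ n.*2)).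
  by rewrite doubleS !qpochSr exprS.
rewrite IH !qpochSr -exprM mul2n; ring.
Qed.

(** Andrews' sum; the denominator pair (w, -w; q)_r with w^2 = q A B is merged into (q A B; q^2)_r,
    so that no square root is needed. It is [q_watson_poly] divided by (q; q^2)_N (q A B; q^2)_N. *)
Lemma q_watson (A B : F) N : q != 0 ->
  P q N.*2 != 0 -> P2 (q * A * B) N != 0 ->
  \sum_(r < N.+1) P (q ^+ N)^-1 r * P (- (q ^+ N)^-1) r * P A r * P B r
    / (P q r * P (q ^+ N.*2)^-1 r * P2 (q * A * B) r) * q ^+ r =
  P2 (q * A) N * P2 (q * B) N / (P2 q N * P2 (q * A * B) N).
Proof.
move=> q0 Hq HD; rewrite q_watson_poly // mulr_suml.
have Hq1 : P q N != 0 by apply: qpoch_neq0_le Hq; rewrite -addnn leq_addr.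
have := Hq; rewrite qpoch_even_odd mulf_eq0 negb_or => /andP[Ho He].
apply: eq_bigr => -[r /= rN] _; rewrite ltnS in rN.
have [d dN] : exists d, N = (d + r)%N by exists (N - r)%N; rewrite subnK.
have -> : (N - r = d)%N by rewrite dN addnK.
have NN : (d.*2 + r + r)%N = N.*2 by rewrite dN doubleD -addnA addnn.
have s0 : q ^+ 2 != 0 by rewrite expf_neq0.
have R1 := @qpoch_rev_split _ q q (d.*2 + r) r q0 q0.
have R2 := @qpoch_rev_split _ (q ^+ 2) (q ^+ 2) d r s0 s0.
have QN : q ^+ N != 0 by rewrite expf_neq0.
have E1 : q / (q ^+ N.*2 * q) = (q ^+ N.*2)^-1.
  by have N2 : q ^+ N.*2 != 0; rewrite ?expf_neq0 //; field_nz.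
have E2 : q ^+ 2 / ((q ^+ 2) ^+ N * q ^+ 2) = ((q ^+ N)^-1) ^+ 2.
  have -> : (q ^+ 2) ^+ N = q ^+ N * q ^+ N by rewrite -expr2 -!exprM mulnC.
  by field_nz.
rewrite NN E1 in R1; rewrite -dN E2 in R2.
rewrite (qpoch_sqr (q ^+ N)^-1) /wcoef.
have sq i : (q ^+ 2) ^+ i = q ^+ i * q ^+ i by rewrite -expr2 -!exprM mulnC.
have e1 : q ^+ ((d.*2 + r) * r) = q ^+ (d * r) * q ^+ (d * r)
    * (q ^+ 'C(r, 2) * q ^+ 'C(r, 2) * q ^+ r).
  by rewrite mulnDl -bin2_sq -addnn mulnDl !exprD.
rewrite !sq in R2; rewrite e1 in R1.
have He' := He; have Hq' := Hq.
rewrite R2 !mulf_eq0 !negb_or -!andbA in He'; case/andP: He' => H1 /andP[H2 _].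
rewrite R1 !mulf_eq0 !negb_or -!andbA in Hq'; case/andP: Hq' => H3 /andP[H4 _].
have H5 : P2 q d != 0 by apply: qpoch_neq0_le Ho; rewrite dN leq_addr.
have H6 : P q r != 0 by apply: qpoch_neq0_le Hq1.
have H7 : P2 (q * A * B) r != 0 by apply: qpoch_neq0_le HD.
have [C0 Qr] : q ^+ 'C(r, 2) != 0 /\ q ^+ r != 0 by rewrite !expf_neq0.
have B0 : q ^+ (d * r) != 0 by rewrite expf_neq0.
have S0 : (-1) ^+ r != 0 :> F by rewrite expf_neq0 // oppr_eq0 oner_neq0.
(* Obtained by reversing the last r factors both of (q; q)_(2N) and of (q^2; q^2)_N, which are
   related by (q; q)_(2N) = (q; q^2)_N (q^2; q^2)_N. *)
have X : P q (d.*2 + r) * (P (q ^- N.*2) r * q ^+ 'C(r, 2)) =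
    P2 q N * (P2 (q ^+ 2) d * P2 ((q ^+ N)^-1 ^+ 2) r).
  apply: (mulIf (mulf_neq0 (mulf_neq0 S0 (mulf_neq0 Qr Qr))
    (mulf_neq0 (mulf_neq0 B0 B0) (mulf_neq0 C0 C0)))).
  move: R1; rewrite qpoch_even_odd R2 => R1.
  by rewrite -[RHS]mulrA [X in _ = _ * X](_ : _ = P2 (q ^+ 2) d * P2 ((q ^+ N)^-1 ^+ 2) r *
    ((-1) ^+ r * (q ^+ r * q ^+ r) * (q ^+ (d * r) * q ^+ (d * r)) *
      (q ^+ 'C(r, 2) * q ^+ 'C(r, 2)))); [rewrite R1; ring | ring].
have {}X : P q (d.*2 + r) = P2 q N * (P2 (q ^+ 2) d * P2 ((q ^+ N)^-1 ^+ 2) r)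
    / (P (q ^- N.*2) r * q ^+ 'C(r, 2)) by rewrite -X; field_nz.
by rewrite X (binS r) bin1 exprD qpoch_even_odd; field_nz.
Qed.

(** * Removal of the integer l *)

Lemma qpoch_exprVn_eq0 k i : q != 0 -> (k < i)%N -> P (q ^+ k)^-1 i = 0.
Proof.
move=> q0 ki; rewrite -(subnKC ki) qpochD qpochSr mulVf ?expf_neq0 //.
by rewrite subrr mulr0 mul0r.
Qed.

Lemma bin2_add i d : 'C(i + d, 2) = ('C(i, 2) + 'C(d, 2) + i * d)%N.
Proof.
elim: d => [|d IH]; first by rewrite addn0 muln0 bin0n !addn0.
by rewrite addnS !binS !bin1 IH mulnS; ring.
Qed.

(** [qpoch_expand] at alpha = y^2 / q, d = - y, b = q^-k; since d^2 = alpha q,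
    the two Pochhammer symbols containing d cancel. *)
Lemma neg_ratio_expand (y : F) k l n : q != 0 -> y != 0 ->
  (k <= n)%N -> (l <= n)%N -> P q n != 0 -> P (- y) n != 0 ->
  P (y ^+ 2) n.*2 != 0 ->
  P (- (q ^+ l * y)) k / P (q ^+ l * y ^+ 2) k =
  \sum_(i < l.+1) P (q ^+ l)^-1 i * y ^+ i * q ^+ (l * i) * q ^+ 'C(i, 2)
    / (P q i * P (q ^+ l * y ^+ 2) i * P (q ^+ i * y ^+ 2 / q) i)
    * P (- y) k
    * (if (i <= k)%N then P q k / (P q (k - i) * P (q ^+ (i + i) * y ^+ 2) (k - i))
       else 0).
Proof.
move=> q0 y0 kn ln Hq Hy Hy2.
have [Qk Ql] : q ^+ k != 0 /\ q ^+ l != 0 by rewrite !expf_neq0.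
have Hql := qpoch_neq0_le ln Hq; have Hqk := qpoch_neq0_le kn Hq.
have Hyl := qpoch_neq0_le ln Hy; have Hyk := qpoch_neq0_le kn Hy.
have Hn a m : (a + m <= n.*2)%N -> P (q ^+ a * y ^+ 2) m != 0.
  move=> am; have := qpoch_neq0_le am Hy2; rewrite qpochD mulf_eq0 negb_or.
  by rewrite mulrC => /andP[].
set Y := y ^+ 2 in Hy2 Hn *.
(* [qpoch_expand] is used at X = 1 and length l. The value of v is chosen so that reversing (v)_l
   gives (-q^k y)_l, and B = q^-k makes the terms with i > k vanish. *)
pose A := q / (q ^+ l * Y * q ^+ k); pose B := (q ^+ k)^-1.
pose v := - (q / (q ^+ l * y * q ^+ k)).
have Y0 : Y != 0 by rewrite expf_neq0.
have A0 : A != 0 by rewrite !mulf_neq0 ?invr_neq0 ?mulf_neq0.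
have v0 : v != 0 by rewrite oppr_eq0 !mulf_neq0 ?invr_neq0 ?mulf_neq0.
have B0 : B != 0 by rewrite invr_neq0.
have HAB a b : (a + b < l)%N -> A * q ^+ a - B * q ^+ b != 0.
  move=> ab; have [c lc] : exists c, l = (a + b + c).+1.
    by exists (l - (a + b).+1)%N; rewrite -addSn subnKC.
  have [Qa Qb] : q ^+ a != 0 /\ q ^+ b != 0 by rewrite !expf_neq0.
  have Qc : q ^+ c != 0 by rewrite expf_neq0.
  have -> : A * q ^+ a - B * q ^+ b =
      (1 - Y * q ^+ (b + b + c)) / (q ^+ (b + c) * Y * q ^+ k).
    by rewrite /A /B lc exprS !exprD; field_nz.
  rewrite !mulf_neq0 ?invr_neq0 ?mulf_neq0 ?expf_neq0 //.
  move/qpoch_neq0P: Hy2; apply; rewrite -addnn.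
  have bl : (b + c < l)%N by rewrite lc ltnS -addnA leq_addl.
  have bl' : (b < l)%N by rewrite lc ltnS -addnA addnC -addnA leq_addr.
  by rewrite -addnA -addSn leq_add ?(leq_trans bl') // ltnW // (leq_trans bl).
have S : P (1 * v) l = _ := qpoch_expand v 1 q0 Hql HAB.
have Pv : P v l = P (- (q ^+ k * y)) l * ((-1) ^+ l * v ^+ l * q ^+ 'C(l, 2)).
  rewrite (qpoch_rev _ q0 v0); congr (P _ _ * _); rewrite /v; field_nz.
(* Two splittings of (-y)_(k+l) exchange the roles of k and l, so the factorial to be expanded has
   length l. *)
have ratio : P (- (q ^+ l * y)) k = P (- y) k * P (- (q ^+ k * y)) l / P (- y) l.
  have := qpochD q (- y) k l; rewrite addnC qpochD.
  rewrite !mulNr ![y * _]mulrC => E; rewrite -E; field_nz.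
have vl0 : (-1) ^+ l * v ^+ l * q ^+ 'C(l, 2) != 0.
  by rewrite !mulf_neq0 ?signr_eq0 ?expf_neq0.
have {S Pv} S : P (- (q ^+ k * y)) l =
   (\sum_(j < l.+1) vcoef A B v j (l - j) * P A (l - j) * P B j)
     / ((-1) ^+ l * v ^+ l * q ^+ 'C(l, 2)).
  move: S; rewrite mul1r Pv => S; apply: (mulIf vl0); rewrite S divfK //.
  by apply: eq_bigr => j _; rewrite !mul1r.
rewrite ratio S !(mulr_suml, mulr_sumr); apply: eq_bigr => -[i /= il] _.
rewrite ltnS in il.
have [d ld] : exists d, l = (i + d)%N by exists (l - i)%N; rewrite subnKC.
have -> : (l - i = d)%N by rewrite ld addKn.
(* For i > k the factor (q^-k)_i is zero, in agreement with the value 0 of the conditional. *)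
case: ifP => ik; last first.
  by rewrite mulr0 (@qpoch_exprVn_eq0 k) ?ltnNge ?ik // !(mulr0, mul0r).
have [g kg] : exists g, k = (g + i)%N by exists (k - i)%N; rewrite subnK.
have -> : (k - i = g)%N by rewrite kg addnK.
have dn : (d <= n)%N by apply: leq_trans ln; rewrite ld leq_addl.
have i_n : (i <= n)%N by apply: leq_trans ln.
have gn : (g <= n)%N by apply: leq_trans kn; rewrite kg leq_addr.
have [Qi Qd] : q ^+ i != 0 /\ q ^+ d != 0 by rewrite !expf_neq0.
have C1 : q ^+ 'C(i, 2) != 0 by rewrite expf_neq0.
have C2 : q ^+ 'C(d, 2) != 0 by rewrite expf_neq0.
have Qid : q ^+ (i * d) != 0 by rewrite expf_neq0.
have Qig : q ^+ (i * g) != 0 by rewrite expf_neq0.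
have S1 j : (-1) ^+ j != 0 :> F by rewrite signr_eq0.
have F1 : P q k = P q g * P B i * ((-1) ^+ i * q ^+ i * q ^+ (i * g) * q ^+ 'C(i, 2)).
  rewrite {1}kg qpoch_rev_split // -kg [(g * i)%N]mulnC.
  by congr (_ * P _ _ * _); rewrite /B; field_nz.
have F5 : P q l = P q d * P (q ^+ l)^-1 i * ((-1) ^+ i * q ^+ i * q ^+ (i * d) * q ^+ 'C(i, 2)).
  rewrite {1}ld addnC qpoch_rev_split // addnC -ld [(d * i)%N]mulnC.
  by congr (_ * P _ _ * _); field_nz.
have F2 : P A d = P (q ^+ (i + k) * Y) d * ((-1) ^+ d * A ^+ d * q ^+ 'C(d, 2)).
  rewrite (qpoch_rev _ q0 A0); congr (P _ _ * _).
  by rewrite /A ld !exprD; field_nz.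
have F6 : P (- y) l = P (- y) i * P (- (q ^+ i * y)) d.
  by rewrite ld qpochD mulNr [y * _]mulrC.
have F4 : P (q ^+ l * Y) k = P (q ^+ l * Y) i * P (q ^+ (l + i) * Y) g.
  by rewrite kg addnC qpochD mulrAC -exprD.
have F4' : P (q ^+ (i + i) * Y) d * P (q ^+ (l + i) * Y) g =
    P (q ^+ (i + i) * Y) g * P (q ^+ (i + k) * Y) d.
  have := qpochD q (q ^+ (i + i) * Y) g d; rewrite addnC qpochD.
  rewrite !(mulrAC _ Y) -!exprD ld kg => E.
  rewrite (_ : i + d + i = i + i + d)%N; last by clear; lia.
  by rewrite E (_ : i + i + g = i + (g + i))%N //; clear; lia.
(* Since v / A = -y, the numerators [hpoch A v i] and [hpoch B v d] supply (-y)_i and (-q^i y)_d.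
   Together they form (-y)_l and cancel the denominator of [ratio]. *)
have hv1 : v / A = - y by rewrite /v /A /Y; field_nz.
have H1 : hpoch A v i = A ^+ i * P (- y) i by rewrite hpochE // hv1.
have hv2 : v / B != 0 by rewrite mulf_neq0 ?invr_neq0.
have H2 : hpoch B v d = v ^+ d * P (- (q ^+ i * y)) d * ((-1) ^+ d * q ^+ 'C(d, 2)).
  rewrite hpochE // (qpoch_rev _ q0 hv2) expr_div_n.
  have -> : q / (q ^+ d * (v / B)) = - (q ^+ i * y).
    by rewrite /v /B ld exprD; field_nz.
  have Bd : B ^+ d != 0 by rewrite expf_neq0.
  by field_nz.
have BQ : B * q ^+ i != 0 by rewrite mulf_neq0.
have AQ : A * q ^+ d != 0 by rewrite mulf_neq0.
have H3 : hpoch (B * q ^+ i) A d =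
    A ^+ d * P (q ^+ (i + i) * Y) d * ((-1) ^+ d * q ^+ 'C(d, 2)).
  rewrite hpochE // (qpoch_rev _ q0 (mulf_neq0 A0 (invr_neq0 BQ))) expr_div_n.
  have -> : q / (q ^+ d * (A / (B * q ^+ i))) = q ^+ (i + i) * Y.
    by rewrite /A /B ld !exprD; field_nz.
  have Bd : (B * q ^+ i) ^+ d != 0 by rewrite expf_neq0.
  by field_nz.
have H4 : hpoch (A * q ^+ d) B i = A ^+ i * q ^+ (i * d) * P (q ^+ i * Y / q) i.
  rewrite hpochE // exprMn -exprM mulnC; congr (_ * P _ _).
  by rewrite /A /B ld exprD; field_nz.
have eii : q ^+ (i * i) = q ^+ 'C(i, 2) * q ^+ 'C(i, 2) * q ^+ i.
  by rewrite -!exprD bin2_sq.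
have eli : q ^+ (l * i) = q ^+ (i * i) * q ^+ (i * d).
  by rewrite ld mulnDl [(d * i)%N]mulnC exprD.
have eki : q ^+ (k * i) = q ^+ (i * i) * q ^+ (i * g).
  by rewrite kg mulnDl [(g * i)%N]mulnC addnC exprD.
have vi : v ^+ i = (-1) ^+ i * q ^+ i / (q ^+ (l * i) * y ^+ i * q ^+ (k * i)).
  by rewrite /v -[in LHS]mulN1r exprMn expr_div_n !exprMn -!exprM mulrA.
have Si : (-1) ^+ i * (-1) ^+ i = 1 :> F by rewrite -exprMn mulrNN mulr1 expr1n.
have Ai : A ^+ i != 0 by rewrite expf_neq0.
have Ad : A ^+ d != 0 by rewrite expf_neq0.
have vd : v ^+ d != 0 by rewrite expf_neq0.
have yi : y ^+ i != 0 by rewrite expf_neq0.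
have Z1 := qpoch_neq0_le i_n Hq; have Z2 := qpoch_neq0_le dn Hq.
have Z3 := qpoch_neq0_le gn Hq.
have gk : (g <= k)%N by rewrite kg leq_addr.
have dl : (d <= l)%N by rewrite ld leq_addl.
have Z4 : P (q ^+ (i + i) * Y) d != 0.
  by apply: Hn; rewrite -addnA -ld -addnn leq_add.
have Z5 : P (q ^+ (l + i) * Y) g != 0.
  by apply: Hn; rewrite -addnA [(i + g)%N]addnC -kg -addnn leq_add.
have Z6 : P (q ^+ (i + i) * Y) g != 0.
  by apply: Hn; rewrite -addnA [(i + g)%N]addnC -kg -addnn leq_add.
have Z7 : P (q ^+ l * Y) i != 0 by apply: Hn; rewrite -addnn leq_add.
have Z8 : P (q ^+ i * Y / q) i != 0.
  (* The exponent i - 1 is meaningful only for i > 0; at i = 0 the product is empty. *)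
  case: (i) i_n => [|i'] i'n; first by rewrite qpoch0 oner_neq0.
  have -> : q ^+ i'.+1 * Y / q = q ^+ i' * Y by rewrite exprS; field_nz.
  apply: Hn.
  by rewrite -addnn leq_add // ltnW.
have [Z9 Z10] : P (- y) i != 0 /\ P (- (q ^+ i * y)) d != 0.
  by move: Hyl; rewrite F6 mulf_eq0 negb_or => /andP[].
have F5' : P (q ^+ l)^-1 i = P q l / (P q d * ((-1) ^+ i * q ^+ i * q ^+ (i * d) * q ^+ 'C(i, 2))).
  by rewrite F5; field_nz.
have F1' : P B i = P q k / (P q g * ((-1) ^+ i * q ^+ i * q ^+ (i * g) * q ^+ 'C(i, 2))).
  by rewrite F1; field_nz.
rewrite F5' F1' F2 F4 F6 /vcoef -ld H1 H2 H3 H4.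
have -> : P (q ^+ (i + k) * Y) d =
  P (q ^+ (i + i) * Y) d * P (q ^+ (l + i) * Y) g / P (q ^+ (i + i) * Y) g.
  by rewrite F4'; field_nz.
have -> : (-1) ^+ l * v ^+ l * q ^+ 'C(l, 2) =
  (-1) ^+ d * v ^+ d * q ^+ i / (q ^+ (l * i) * y ^+ i * q ^+ (k * i))
  * (q ^+ 'C(i, 2) * q ^+ 'C(d, 2) * q ^+ (i * d)).
  have Qli : q ^+ (l * i) != 0 by rewrite expf_neq0.
  have Qki : q ^+ (k * i) != 0 by rewrite expf_neq0.
  rewrite [in LHS]ld bin2_add !exprD vi -[RHS]mul1r -[X in _ = X * _]Si; field_nz.
rewrite eli eki eii.
set m1 := (-1) ^+ i; have m10 : m1 != 0 by rewrite signr_eq0.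
set m2 := (-1) ^+ d; have m20 : m2 != 0 by rewrite signr_eq0.
move: Z1 Z2 Z3 Z4 Z5 Z6 Z7 Z8 Z9 Z10 Ai Ad vd yi m10 m20 Qi Qd C1 C2 Qid Qig.
clearbody m1 m2; clear.
move: (A ^+ i) (A ^+ d) (v ^+ d) => *; field_nz.
Qed.

Lemma sum_ord_shift (V : nmodType) (f : nat -> V) i n : (i <= n)%N ->
  (forall k, (k < i)%N -> f k = 0) ->
  \sum_(k < n.+1) f k = \sum_(r < (n - i).+1) f (i + r)%N.
Proof.
move=> i_n f0; rewrite -!(big_mkord xpredT) (@big_cat_nat _ _ _ i) //=; last exact: leqW.
rewrite big_nat big1 ?add0r => [|k /andP[_ ki]]; last exact: f0.
rewrite -{1}(add0n i) big_addn subSn // !big_mkord.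
by apply: eq_bigr => r _; rewrite addnC.
Qed.

(** The ratio of factorials containing l is expanded by [neg_ratio_expand] and the sums are
    exchanged. The i-th inner sum starts at k = i; with k = i + r it is a q-Watson sum of length n -
    i in A q^i and B q^i. *)
Lemma q_watson_ext (A B w : F) n l : q != 0 -> w ^+ 2 = q * A * B ->
  (l <= n)%N -> P q n.*2 != 0 -> P (- q) n != 0 -> P w n != 0 -> P (- w) n != 0 ->
  let y := (q ^+ n)^-1 in
  \sum_(k < n.+1) P y k * P (- (q ^+ l * y)) k * P A k * P B k
     / (P q k * P (q ^+ l * y ^+ 2) k * P w k * P (- w) k) * q ^+ k =
  \sum_(i < l.+1) y ^+ i * q ^+ (l * i) * q ^+ 'C(i.+1, 2)
    * (P (q ^+ l)^-1 i * P y i * P (- y) i * P A i * P B i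
       / (P q i * P w i * P (- w) i * P (q ^+ l * y ^+ 2) i * P (q ^+ i * y ^+ 2 / q) i))
    * (P2 (q * (A * q ^+ i)) (n - i) * P2 (q * (B * q ^+ i)) (n - i)
       / (P2 q (n - i) * P2 (q * (A * q ^+ i) * (B * q ^+ i)) (n - i))).
Proof.
move=> q0 Ew ln Hq2 Hmq Hw Hmw y.
have Hq : P q n != 0 by apply: qpoch_neq0_le Hq2; rewrite -addnn leq_addr.
have Qn : q ^+ n != 0 by rewrite expf_neq0.
have y0 : y != 0 by rewrite invr_neq0.
have Hy : P (- y) n != 0.
  move: Hmq; rewrite (@qpoch_rev _ q (- q)) ?oppr_eq0 // mulf_eq0 negb_or.
  have -> : q / (q ^+ n * - q) = - y by rewrite /y; field_nz.
  by case/andP.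
have Hy2 : P (y ^+ 2) n.*2 != 0.
  move: Hq2; rewrite (@qpoch_rev _ q q) // mulf_eq0 negb_or.
  have -> : q / (q ^+ n.*2 * q) = y ^+ 2.
    by rewrite -addnn exprD /y; field_nz.
  by case/andP.
pose Cf i := P (q ^+ l)^-1 i * y ^+ i * q ^+ (l * i) * q ^+ 'C(i, 2)
    / (P q i * P (q ^+ l * y ^+ 2) i * P (q ^+ i * y ^+ 2 / q) i).
pose f i k := P y k * P A k * P B k / (P q k * P w k * P (- w) k) * q ^+ k
  * (Cf i * P (- y) k
    * (if (i <= k)%N then P q k / (P q (k - i) * P (q ^+ (i + i) * y ^+ 2) (k - i))
       else 0)).
transitivity (\sum_(i < l.+1) \sum_(k < n.+1) f i k).
  rewrite exchange_big /=; apply: eq_bigr => -[k /= kn] _; rewrite ltnS in kn.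
  rewrite -mulr_sumr -(neg_ratio_expand q0 y0 kn ln Hq Hy Hy2).
  by rewrite !invfM; ring.
apply: eq_bigr => -[i /= il] _; rewrite ltnS in il.
have i_n := leq_trans il ln.
rewrite (@sum_ord_shift _ (f i) i n i_n); last first.
  by move=> k ki; rewrite /f leqNgt ki !mulr0.
set N := (n - i)%N; have nN : n = (i + N)%N by rewrite subnKC.
have HqN : P q N.*2 != 0 by apply: qpoch_neq0_le Hq2; rewrite leq_double leq_subr.
(* The q-Watson relation survives the shift: w q^i plays the role of w. *)
have D2 : q * (A * q ^+ i) * (B * q ^+ i) = (w * q ^+ i) ^+ 2.
  by rewrite exprMn Ew; ring.
have [Zw Zwi] : P w i != 0 /\ P (w * q ^+ i) N != 0.
  by move: Hw; rewrite nN qpochD mulf_eq0 negb_or => /andP[].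
have [Zm Zmi] : P (- w) i != 0 /\ P (- (w * q ^+ i)) N != 0.
  by move: Hmw; rewrite nN qpochD mulNr mulf_eq0 negb_or => /andP[].
have HD : P2 (q * (A * q ^+ i) * (B * q ^+ i)) N != 0.
  by rewrite D2 -qpoch_sqr mulf_neq0.
rewrite -(q_watson q0 HqN HD) mulr_sumr; apply: eq_bigr => -[r /= rN] _.
rewrite ltnS in rN; rewrite /f leq_addr addKn.
have Yi : y * q ^+ i = (q ^+ N)^-1.
  have [Qi QN] : q ^+ i != 0 /\ q ^+ N != 0 by rewrite !expf_neq0.
  by rewrite /y nN exprD; field_nz.
have Yii : q ^+ (i + i) * y ^+ 2 = (q ^+ N.*2)^-1.
  by rewrite -[N.*2]addnn !exprD invfM -Yi; ring.
rewrite Yii !(qpochD _ _ i r) !mulNr Yi D2 -qpoch_sqr binS bin1 !exprD /Cf.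
have Z : P q (i + r) != 0.
  by apply: qpoch_neq0_le Hq; rewrite nN leq_add2l.
move: Z; rewrite qpochD mulf_eq0 negb_or => /andP[Z1 Z2].
rewrite !invfM.
move: (P w i)^-1 (P (- w) i)^-1 (P (w * _) r)^-1 (P (- (w * _)) r)^-1
  (P (q ^- N.*2) r)^-1 (P (q ^+ l * _) i)^-1 (P (q ^+ i * _ / q) i)^-1 (P q r)^-1.
by move=> *; field_nz.
Qed.

(** * Removal of the integer m *)

(** [qpoch_expand] at X = q^k; again d^2 = alpha q for d = v / A. *)
Lemma shift_expand (A B v s : F) (m k : nat) : q != 0 -> A != 0 -> B != 0 -> v != 0 ->
  v ^+ 2 * q ^+ m = q * A * B -> s = v / B ->
  P q m != 0 -> P (q / (q ^+ m * A)) m != 0 -> P (A / B) m.+1 != 0 ->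
  P (q * B / A) m != 0 -> P v (m + k) != 0 ->
  let al := B / (q ^+ m * A) in
  P A k * P B k / P v k = P A m * P s m / (P (A / B) m * P v m) *
  \sum_(j < m.+1) (q ^+ 3 / v) ^+ j
    * ((1 - q ^+ m * (A / B) / q ^+ (j + j)) / (1 - q ^+ m * (A / B)))
    * (P (q ^+ m)^-1 j * P B j * P al j
       / (P q j * P (q / (q ^+ m * A)) j * P (q * B / A) j))
    * (P (A * q ^+ (m - j)) k * P (B * q ^+ j) k / P (v * q ^+ m) k).
Proof.
move=> q0 A0 B0 v0 Ev Es Hq HA Hr Hr' Hv al.
have s0 : s != 0 by rewrite Es mulf_neq0 ?invr_neq0.
set rho := A / B in Hr *.
have rho0 : rho != 0 by rewrite mulf_neq0 ?invr_neq0.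
have Erho' : q * B / A = q / rho by rewrite /rho; field_nz.
rewrite Erho' in Hr' *.
have Qm : q ^+ m != 0 by rewrite expf_neq0.
have HPA : P A m != 0.
  by rewrite (qpoch_rev _ q0 A0) !mulf_neq0 ?signr_eq0 ?expf_neq0.
(* Up to a nonzero monomial the difference is a factor of (A/B)_(m+1) if b <= a, and a factor of (q
   B/A)_m otherwise. *)
have HAB a b : (a + b < m)%N -> A * q ^+ a - B * q ^+ b != 0.
  move=> ab; have Eab : A * q ^+ a - B * q ^+ b = B * (rho * q ^+ a - q ^+ b).
    by rewrite /rho; field_nz.
  rewrite Eab mulf_neq0 //; case: (leqP b a) => ba.
    have -> : rho * q ^+ a - q ^+ b = - (q ^+ b * (1 - rho * q ^+ (a - b))).
      by rewrite -{1}(subnKC ba) exprD; ring.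
    rewrite oppr_eq0 mulf_neq0 ?expf_neq0 //; move/qpoch_neq0P: Hr; apply.
    by apply/ltnW; rewrite ltnS (leq_trans _ ab) // ltnS (leq_trans (leq_subr _ _)) ?leq_addr.
  have [t bt] : exists t, b = (a + t).+1 by exists (b - a.+1)%N; rewrite -addSn subnKC.
  have -> : rho * q ^+ a - q ^+ b = rho * q ^+ a * (1 - q / rho * q ^+ t).
    by rewrite bt exprS exprD; field_nz.
  rewrite mulf_neq0 ?(mulf_neq0 rho0) ?expf_neq0 //; move/qpoch_neq0P: Hr'; apply.
  by apply: leq_trans ab; rewrite bt addnS addnA ltnS; apply/leqW/leq_addl.
have Hvk : P v k != 0 by apply: qpoch_neq0_le Hv; rewrite leq_addl.
have [Hvm Hvmk] : P v m != 0 /\ P (v * q ^+ m) k != 0.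
  by move: Hv; rewrite qpochD mulf_eq0 negb_or => /andP[].
have S := qpoch_expand v (q ^+ k) q0 Hq HAB.
(* Both sides are (v)_(m+k). Dividing by (v)_k thus amounts to multiplying by (q^k v)_m, which is
   the factorial that gets expanded. *)
have Evk : P v k * P (q ^+ k * v) m = P v m * P (v * q ^+ m) k.
  by rewrite [q ^+ k * v]mulrC -!qpochD addnC.
rewrite (_ : P A k * P B k / P v k =
    P A k * P B k * P (q ^+ k * v) m / (P v m * P (v * q ^+ m) k)); last first.
  have Hz : P (q ^+ k * v) m != 0.
    move: Hv; rewrite addnC qpochD mulf_eq0 negb_or [v * _]mulrC.
    by case/andP.
  by rewrite -Evk; field_nz.
rewrite S !(mulr_sumr, mulr_suml); apply: eq_bigr => -[j /= jm] _; rewrite ltnS in jm.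
have [d md] : exists d, m = (j + d)%N by exists (m - j)%N; rewrite subnKC.
have -> : (m - j = d)%N by rewrite md addKn.
have EA : P A k * P (q ^+ k * A) d = P A d * P (A * q ^+ d) k.
  by rewrite [q ^+ k * A]mulrC -!qpochD addnC.
have EB : P B k * P (q ^+ k * B) j = P B j * P (B * q ^+ j) k.
  by rewrite [q ^+ k * B]mulrC -!qpochD addnC.
have CI : vcoef A B v j d * P A d = P A m * P s m / P rho m * ((q ^+ 3 / v) ^+ j
    * ((1 - q ^+ m * rho / q ^+ (j + j)) / (1 - q ^+ m * rho))
    * (P (q ^+ m)^-1 j * P al j
       / (P q j * P (q / (q ^+ m * A)) j * P (q / rho) j))).
  have [Qj Qd] : q ^+ j != 0 /\ q ^+ d != 0 by rewrite !expf_neq0.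
  have qm : q ^+ m = q ^+ j * q ^+ d by rewrite md exprD.
  have c0 : q ^+ 'C(j, 2) != 0 by rewrite expf_neq0.
  have x0 : q ^+ (d * j) != 0 by rewrite expf_neq0.
  have sj0 : (-1) ^+ j != 0 :> F by rewrite signr_eq0.
  have [Aj Bj] : A ^+ j != 0 /\ B ^+ j != 0 by rewrite !expf_neq0.
  have [Bd vj] : B ^+ d != 0 /\ v ^+ j != 0 by rewrite !expf_neq0.
  have BQ : B * q ^+ j != 0 by rewrite mulf_neq0.
  have AQ : A * q ^+ d != 0 by rewrite mulf_neq0.
  have al0 : al != 0 by rewrite mulf_neq0 // invr_neq0 // mulf_neq0.
  have qr0 : q / rho != 0 by rewrite mulf_neq0 // invr_neq0.
  have bad0 : B / (A * q ^+ d) != 0 by rewrite mulf_neq0 // invr_neq0.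
  (* The cancellation due to d^2 = alpha q: up to monomials, (v/B)_d (v/A)_j from the two numerators
     of [vcoef] is the single factorial (s)_m. *)
  have Esv : q / (q ^+ m * s) = v / A.
    rewrite Es; have -> : A = v ^+ 2 * q ^+ m / (q * B) by rewrite Ev; field_nz.
    by field_nz.
  have E1 : P q m = P q d * P (q ^+ m)^-1 j
      * ((-1) ^+ j * q ^+ j * q ^+ (d * j) * q ^+ 'C(j, 2)).
    rewrite {1}md addnC qpoch_rev_split // addnC -md; congr (_ * P _ _ * _).
    by field_nz.
  have E2 : P A m = P A d * P (q / (q ^+ m * A)) j
      * ((-1) ^+ j * A ^+ j * q ^+ (d * j) * q ^+ 'C(j, 2)).
    by rewrite {1}md addnC qpoch_rev_split // addnC -md.
  have E3 : P s m = P s d * P (v / A) j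
      * ((-1) ^+ j * s ^+ j * q ^+ (d * j) * q ^+ 'C(j, 2)).
    by rewrite {1}md addnC qpoch_rev_split // addnC -md Esv.
  have E4 : P (B / (A * q ^+ d)) j = P (rho * q ^+ d * q / q ^+ j) j
      * ((-1) ^+ j * (B / (A * q ^+ d)) ^+ j * q ^+ 'C(j, 2)).
    rewrite (qpoch_rev _ q0 bad0); congr (P _ _ * _); rewrite /rho; field_nz.
  have E5 : P al j = P (rho * q ^+ d.+1) j
      * ((-1) ^+ j * al ^+ j * q ^+ 'C(j, 2)).
    rewrite (qpoch_rev _ q0 al0); congr (P _ _ * _).
    by rewrite /rho /al qm exprS; field_nz.
  have E6 : P (q / rho) j = P (rho / q ^+ j) j
      * ((-1) ^+ j * (q / rho) ^+ j * q ^+ 'C(j, 2)).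
    rewrite (qpoch_rev _ q0 qr0); congr (P _ _ * _); field_nz.
  (* Both sides are (rho q^-j)_(m+1). The isolated factor 1 - rho q^(d-j) is the very-well-poised
     factor 1 - q^m rho / q^(2j). *)
  have E7 : P (rho / q ^+ j) d * (1 - rho / q ^+ j * q ^+ d)
      * P (rho * q ^+ d * q / q ^+ j) j = P (rho / q ^+ j) j * P rho d.+1.
    have -> : rho * q ^+ d * q / q ^+ j = rho / q ^+ j * q ^+ d.+1.
      by rewrite exprSr; ring.
    by rewrite -qpochSr -qpochD addnC qpochD divfK.
  have E8 : P rho m * (1 - rho * q ^+ m) = P rho d.+1 * P (rho * q ^+ d.+1) j.
    by rewrite -qpochSr -qpochD md addSn addnC.
  have dm1 : (d < m.+1)%N by rewrite ltnS md leq_addl.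
  have dm : (d <= m)%N by [].
  have Hj := qpoch_neq0_le jm Hr'; have Hd1 := qpoch_neq0_le dm1 Hr.
  have Hm := Hr; rewrite qpochSr E8 mulf_eq0 negb_or in Hm.
  have {Hm} /andP[_ N2] := Hm.
  have := Hr; rewrite qpochSr mulf_eq0 negb_or => /andP[N3 N4].
  have Hj' := Hj; rewrite E6 mulf_eq0 negb_or in Hj'.
  have {Hj'} /andP[N1 _] := Hj'.
  have := mulf_neq0 N1 Hd1; rewrite -E7 !mulf_eq0 !negb_or.
  case/andP=> /andP[N5 N6] N7.
  have Hqj := qpoch_neq0_le jm Hq; have Hqd := qpoch_neq0_le dm Hq.
  have N8 : P (q / (q ^+ m * A)) j != 0 by apply: qpoch_neq0_le HA.
  have hv : v / B = s by rewrite Es.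
  have eii : q ^+ (j * j) = q ^+ 'C(j, 2) * q ^+ 'C(j, 2) * q ^+ j.
    by rewrite -!exprD bin2_sq.
  have p1 : (B * q ^+ j) ^+ d = B ^+ d * q ^+ (d * j) by rewrite exprMn -exprM mulnC.
  have p2 : (A * q ^+ d) ^+ j = A ^+ j * q ^+ (d * j) by rewrite exprMn -exprM.
  have p3 : (B / (A * q ^+ d)) ^+ j = B ^+ j / (A ^+ j * q ^+ (d * j)).
    by rewrite expr_div_n p2.
  have p4 : al ^+ j = B ^+ j / (A ^+ j * (q ^+ (d * j)
      * (q ^+ 'C(j, 2) * q ^+ 'C(j, 2) * q ^+ j))).
    rewrite -eii -exprD -mulnDl addnC -md exprM mulrC /al expr_div_n exprMn.
    by field_nz; rewrite expf_neq0.
  have p5 : (q / rho) ^+ j = q ^+ j * B ^+ j / A ^+ j.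
    by rewrite -exprMn -expr_div_n; congr (_ ^+ _); rewrite /rho; field_nz.
  have p6 : (q ^+ 3 / v) ^+ j = q ^+ j * q ^+ j * q ^+ j / v ^+ j.
    by rewrite expr_div_n -!exprMn !exprS expr0 mulr1 mulrA.
  have p7 : s ^+ j = v ^+ j / B ^+ j by rewrite Es expr_div_n.
  have -> : P rho m = P rho d.+1 * P (rho * q ^+ d.+1) j / (1 - rho * q ^+ m).
    by rewrite -E8; field_nz.
  rewrite /vcoef -md !hpochE // E1 E2 E3 E4 E5 E6.
  have -> : P (rho / q ^+ j) j = P (rho / q ^+ j) d * (1 - rho / q ^+ j * q ^+ d)
      * P (rho * q ^+ d * q / q ^+ j) j / P rho d.+1 by rewrite E7; field_nz.
  have -> : A / (B * q ^+ j) = rho / q ^+ j by rewrite /rho; field_nz.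
  rewrite p1 p2 p3 p4 p5 p6 p7 hv [(j * d)%N]mulnC exprD.
  rewrite [q ^+ m * rho]mulrC.
  move: (P (q ^- m) j) (P (q / (q ^+ m * A)) j) N8 => t1 t2 N8.
  rewrite qm in N4 *.
  have N6' : q ^+ j - rho * q ^+ d != 0.
    have -> : q ^+ j - rho * q ^+ d = q ^+ j * (1 - rho / q ^+ j * q ^+ d).
      by field_nz.
    by rewrite mulf_neq0.
  move: (P rho d.+1) (P (rho * q ^+ d.+1) j) (P (rho / q ^+ j) d)
    (P (rho * q ^+ d * q / q ^+ j) j) Hd1 N2 N5 N7 => t3 t4 t5 t6 Hd1 N2 N5 N7.
  (* As (-1)^j is about to become an unknown, its powers on the two sides are matched by inserting
     its square, which is 1. *)
  have Sj : (-1) ^+ j * (-1) ^+ j = 1 :> F by rewrite -exprMn mulrNN mulr1 expr1n.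
  rewrite -[LHS]mul1r -[X in X * _ = _]Sj.
  move: Qj Qd c0 x0 sj0 Aj Bj Bd vj Hqj Hqd N8 N4 N6 N6' Hd1 N2 N5 N7.
  clearbody rho; clear.
  move: (P q d) (P q j) (q ^+ j) (q ^+ d) (q ^+ 'C(j, 2)) (q ^+ (d * j)) ((-1) ^+ j)
    (A ^+ j) (B ^+ j) (B ^+ d) (v ^+ j) (P (v / A) j) (P s d) (P A d).
  by move=> *; field_nz.
transitivity (vcoef A B v j d * P A d * P B j * P (A * q ^+ d) k * P (B * q ^+ j) k
   / (P v m * P (v * q ^+ m) k)).
  transitivity (vcoef A B v j d * (P A k * P (q ^+ k * A) d) * (P B k * P (q ^+ k * B) j)
   / (P v m * P (v * q ^+ m) k)); first by ring.
  by rewrite EA EB; ring.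
by rewrite CI !invfM; ring.
Qed.

(** * Identification of the summand and assembly *)

(** The summand is the j-th coefficient of [shift_expand] times the i-th term of [q_watson_ext] at
    the shifted parameters [Aj] and [Bj]. The proof translates integer powers of q into the
    parameters of those two lemmas. *)
Lemma Tterm_factor (a c qh ah ch : F) (l m n i j : nat) :
  qh != 0 -> ah != 0 -> ch != 0 ->
  qh ^+ 2 = q -> ah ^+ 2 = a -> ch ^+ 2 = c -> (j <= m)%N ->
  let y := (q ^+ n)^-1 in
  let A := q ^+ m * y * a in let B := y / c in let v := y * (qh * ah / ch) in
  let w := v * q ^+ m in let rho := A / B in
  let Aj := A * q ^+ (m - j) in let Bj := B * q ^+ j in
  Tterm q a c qh ah ch l m n i j =
  (q ^+ 3 / v) ^+ j * ((1 - q ^+ m * rho / q ^+ (j + j)) / (1 - q ^+ m * rho))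
  * (P (q ^+ m)^-1 j * P B j * P (B / (q ^+ m * A)) j
       / (P q j * P (q / (q ^+ m * A)) j * P (q * B / A) j))
  * (y ^+ i * q ^+ (l * i) * q ^+ 'C(i.+1, 2)
    * (P (q ^+ l)^-1 i * P y i * P (- y) i * P Aj i * P Bj i
       / (P q i * P w i * P (- w) i * P (q ^+ l * y ^+ 2) i * P (q ^+ i * y ^+ 2 / q) i))
    * (qpoch (q * (Aj * q ^+ i)) (q ^+ 2) (n - i)
        * qpoch (q * (Bj * q ^+ i)) (q ^+ 2) (n - i)
       / (qpoch q (q ^+ 2) (n - i)
         * qpoch (q * (Aj * q ^+ i) * (Bj * q ^+ i)) (q ^+ 2) (n - i)))).
Proof.
move=> qh0 ah0 ch0 Eq Ea Ec jm y A B v w rho Aj Bj.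
have q0 : q != 0 by rewrite -Eq expf_neq0.
have a0 : a != 0 by rewrite -Ea expf_neq0.
have c0 : c != 0 by rewrite -Ec expf_neq0.
rewrite /Tterm /qpochs !big_cons !big_nil !mulr1.
have zn k : q ^ k%:Z = q ^+ k by [].
have zN k : q ^ (- k%:Z) = (q ^+ k)^-1 by rewrite -exprnN.
have z1 : q ^ 1 = q by [].
have z2 k : q ^ (2 * k%:Z) = q ^+ k * q ^+ k by rewrite -exprD addnn -mul2n.
have zN2 k : q ^ (- (2 * k%:Z)) = (q ^+ k * q ^+ k)^-1.
  by rewrite -exprD addnn -mul2n -exprnN.
have zN1 : q ^ (- 1) = q^-1 by rewrite exprN1.
pose zE := (z2, zN2, zN1, z1, zN, zn).
have Qn k : q ^+ k != 0 by rewrite expf_neq0.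
have mj : q ^+ m = q ^+ (m - j) * q ^+ j by rewrite -exprD subnK.
have u20 : (qh * ah / ch) != 0 by rewrite mulf_neq0 ?invr_neq0 ?mulf_neq0.
have y0 : y != 0 by rewrite invr_neq0.
have v0 : v != 0 by rewrite mulf_neq0.
have Eu : (qh * ah / ch) ^+ 2 = q * a / c by rewrite -Eq -Ea -Ec; field_nz.
have rhoE : rho = q ^+ m * a * c by rewrite /rho /A /B; field_nz.
have -> : q ^ (2 * m%:Z - 2 * j%:Z) * a * c = q ^+ m * rho / q ^+ (j + j).
  by rewrite expfzDr // !zE rhoE exprD; field_nz.
have -> : q ^+ (2 * m) * a * c = q ^+ m * rho.
  by rewrite rhoE mul2n -addnn exprD; ring.
have -> : q ^ (- 2 * m%:Z) / (a * c) = B / (q ^+ m * A).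
  by rewrite mulNr !zE /A /B; field_nz.
have -> : q ^ (1 - 2 * m%:Z + n%:Z) / a = q / (q ^+ m * A).
  by rewrite !expfzDr // !zE /A /y; field_nz.
have -> : q ^ (1 - m%:Z) / (a * c) = q * B / A.
  by rewrite !expfzDr // !zE /A /B; field_nz.
have -> : q ^ (2 * m%:Z - n%:Z - j%:Z) * a = Aj.
  by rewrite !expfzDr // !zE /Aj /A mj /y; field_nz.
have -> : q ^ (j%:Z - n%:Z) / c = Bj.
  by rewrite !expfzDr // !zE /Bj /B /y; field_nz.
have -> : q ^ (m%:Z - n%:Z) * (qh * ah / ch) = w.
  by rewrite !expfzDr // !zE /w /v /y; ring.
have -> : q ^ (l%:Z - 2 * n%:Z) = q ^+ l * y ^+ 2.
  by rewrite !expfzDr // !zE /y; field_nz.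
have -> : q ^ (i%:Z - 2 * n%:Z - 1) = q ^+ i * y ^+ 2 / q.
  by rewrite !expfzDr // !zE /y; field_nz.
have -> : q ^ (1 + 2 * m%:Z - n%:Z + i%:Z - j%:Z) * a = q * (Aj * q ^+ i).
  by rewrite !expfzDr // !zE /Aj /A mj /y; field_nz.
have -> : q ^ (1 - n%:Z + i%:Z + j%:Z) / c = q * (Bj * q ^+ i).
  by rewrite !expfzDr // !zE /Bj /B /y; field_nz.
have -> : q ^ (1 + 2 * m%:Z - 2 * n%:Z + 2 * i%:Z) * a / c =
    q * (Aj * q ^+ i) * (Bj * q ^+ i).
  by rewrite !expfzDr // !zE /Aj /Bj /B /A mj /y; field_nz.
have -> : q ^ ((l%:Z - n%:Z) * i%:Z + 'C(i.+1, 2)%:Z + n%:Z * j%:Z) =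
    q ^+ (l * i) * y ^+ i * q ^+ 'C(i.+1, 2) * q ^+ (n * j).
  rewrite !expfzDr // mulrDl expfzDr // -!PoszM mulNr -PoszM !zE.
  by rewrite /y exprVn -exprM.
(* Origin of the half-integer powers: q^3 / v = q^n q^(5/2) (c/a)^(1/2). *)
have Ep : (q ^+ 3 / v) ^+ j = q ^+ (n * j) * qh ^+ (5 * j) * (ch / ah) ^+ j.
  rewrite !exprM -!exprMn; congr (_ ^+ _).
  by rewrite /v /y -Eq -exprM; field_nz; rewrite -?exprM expf_neq0.
rewrite Ep !zE.
by rewrite -/y -/B !invfM; ring.
Qed.

(** The identity over an arbitrary field. The j- and i-dependent denominators are constrained at
    their longest instances j = m and i = 0, of which the other instances are factors. *)
Lemma phi43_double_sum (a c qh ah ch : F) (l m n : nat)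
  (hq0 : q != 0) (ha0 : a != 0) (hc0 : c != 0)
  (hqh : qh ^+ 2 = q) (hah : ah ^+ 2 = a) (hch : ch ^+ 2 = c)
  (hln : (l <= n)%N)
  (hd_phi : qpochs [:: q; - q; q ^ (1 - l%:Z + m%:Z) * a; q * c] q n != 0)
  (hd_m : qpochs [:: q ^+ m * a * c; q ^ (- n%:Z) * (qh * ah / ch)] q m != 0)
  (hd_T0 : 1 - q ^+ (2 * m) * a * c != 0)
  (hd_Tj : qpochs [:: q; q ^ (1 - 2 * m%:Z + n%:Z) / a;
                q ^ (1 - m%:Z) / (a * c)] q m != 0)
  (hd_Tq2 : qpochs [:: q; q ^ (1 + 2 * m%:Z - 2 * n%:Z) * a / c]
            (q ^+ 2) n != 0) :
  phi43 n (q ^ (- n%:Z)) (q ^ (1 - l%:Z + n%:Z)) (qh * ah * ch)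
        (- (q ^+ m * (qh * ah * ch)))
        (- q) (q ^ (1 - l%:Z + m%:Z) * a) (q * c) q q
  = qpochs [:: q ^ (- n%:Z) * (qh * ah / ch);
               - (q ^ (m%:Z - n%:Z) * (qh * ah / ch));
               q ^ (1 - l%:Z + n%:Z)] q n
    / qpochs [:: q ^ (1 - l%:Z + m%:Z) * a; q ^ (- n%:Z) / c; - q] q n
    * (qpochs [:: q ^ (m%:Z - n%:Z) * a; qh * ah * ch] q m
       / qpochs [:: q ^+ m * a * c; q ^ (- n%:Z) * (qh * ah / ch)] q m)
    * \sum_(i < l.+1) \sum_(j < m.+1) Tterm q a c qh ah ch l m n i j.
Proof.
have [qh0 ah0] : qh != 0 /\ ah != 0.
  by move: hq0 ha0; rewrite -hqh -hah !expf_eq0 /=.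
have ch0 : ch != 0 by move: hc0; rewrite -hch expf_eq0.
have Qn k : q ^+ k != 0 by rewrite expf_neq0.
have zn k : q ^ k%:Z = q ^+ k by [].
have zN k : q ^ (- k%:Z) = (q ^+ k)^-1 by rewrite -exprnN.
have z1 : q ^ 1 = q by [].
have z2 k : q ^ (2 * k%:Z) = q ^+ k * q ^+ k by rewrite -exprD addnn -mul2n.
have zN2 k : q ^ (- (2 * k%:Z)) = (q ^+ k * q ^+ k)^-1.
  by rewrite -exprD addnn -mul2n -exprnN.
pose zE := (z2, zN2, z1, zN, zn).
pose y := (q ^+ n)^-1; pose A := q ^+ m * y * a; pose B := y / c.
pose u := qh * ah / ch; pose v := y * u; pose s := qh * ah * ch.
(* [W] and [X] are the second upper and second lower parameter of the 4phi3, [s] is sqrt(qac) and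
   [u] is sqrt(qa/c). *)
pose w := v * q ^+ m; pose W := q * q ^+ n / q ^+ l.
pose X := q * q ^+ m / q ^+ l * a.
have y0 : y != 0 by rewrite invr_neq0.
have u0 : u != 0 by rewrite mulf_neq0 ?invr_neq0 ?mulf_neq0.
have s0 : s != 0 by rewrite !mulf_neq0.
have v0 : v != 0 by rewrite mulf_neq0.
have A0 : A != 0 by rewrite !mulf_neq0.
have B0 : B != 0 by rewrite mulf_neq0 ?invr_neq0.
have W0 : W != 0 by rewrite !mulf_neq0 ?invr_neq0.
have X0 : X != 0 by rewrite !mulf_neq0 ?invr_neq0.
have eX : q ^ (1 - l%:Z + m%:Z) * a = X.
  by rewrite !expfzDr // !zE /X; field_nz.
have eW : q ^ (1 - l%:Z + n%:Z) = W by rewrite !expfzDr // !zE /W; field_nz.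
have ew : q ^ (m%:Z - n%:Z) * u = w by rewrite expfzDr // !zE /w /v /y; ring.
have ey : q ^ (- n%:Z) = y by rewrite zE.
have eA : q ^ (m%:Z - n%:Z) * a = A by rewrite expfzDr // !zE /A /y; ring.
have eAB : q ^+ m * a * c = A / B by rewrite /A /B; field_nz.
have eT0 : q ^+ (2 * m) * a * c = q ^+ m * (A / B).
  by rewrite -eAB mul2n -addnn exprD; ring.
have eTj1 : q ^ (1 - 2 * m%:Z + n%:Z) / a = q / (q ^+ m * A).
  by rewrite !expfzDr // !zE /A /y; field_nz.
have eTj2 : q ^ (1 - m%:Z) / (a * c) = q * B / A.
  by rewrite expfzDr // !zE /A /B; field_nz.
have us : u ^+ 2 = q * a / c by rewrite /u -hqh -hah -hch; field_nz.
have eTq2 : q ^ (1 + 2 * m%:Z - 2 * n%:Z) * a / c = w ^+ 2.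
  have -> : w ^+ 2 = y ^+ 2 * u ^+ 2 * (q ^+ m) ^+ 2 by rewrite /w /v; ring.
  by rewrite !expfzDr // !zE us /y; field_nz.
rewrite ?ey in hd_m *; rewrite ?eX ?eW -/u ?ew ?eA ?eAB -/s -/v -/B in hd_phi hd_m *.
rewrite eT0 in hd_T0; rewrite eTj1 eTj2 in hd_Tj; rewrite eTq2 in hd_Tq2.
rewrite /qpochs !big_cons !big_nil !mulr1 in hd_phi hd_m hd_Tj hd_Tq2 *.
move: hd_phi hd_m hd_Tj hd_Tq2; rewrite !mulf_eq0 !negb_or.
case/and4P=> Hq Hmq HX Hc /andP[HAB Hv] /and3P[Hqm HA HBA] /andP[Ho Hw2].
move: Hw2; rewrite -qpoch_sqr mulf_eq0 negb_or => /andP[Hw Hmw].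
have Hq2 : P q n.*2 != 0.
  by rewrite qpoch_even_odd -qpoch_sqr !mulf_neq0.
(* W = q^(1+n-l), so (W)_n is the tail of (q)_(2n-l), which divides (q)_(2n). *)
have HW : P W n != 0.
  have -> : W = q * q ^+ (n - l).
    have E : q ^+ n = q ^+ (n - l) * q ^+ l by rewrite -exprD subnK.
    by rewrite /W E; field_nz.
  have : P q ((n - l) + n) != 0.
    by apply: qpoch_neq0_le Hq2; rewrite -addnn leq_add2r leq_subr.
  by rewrite qpochD mulf_eq0 negb_or => /andP[].
have Hvmk k : (k <= n)%N -> P v (m + k) != 0.
  by move=> kn; rewrite qpochD mulf_neq0 // (qpoch_neq0_le kn).
have Hvn : P v n != 0 by apply: qpoch_neq0_le (Hvmk n (leqnn n)); rewrite leq_addl.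
(* Sears is applied with z = q c, so the parameter called A in [sears_rev] is [B] here, while [A]
   arises as X / W. *)
have eB : q / (q ^+ n * (q * c)) = B by rewrite /B /y; field_nz.
have esB : s * B = v.
  by rewrite /s /B /v /u -hch; field_nz.
have etB : - (q ^+ m * s) * B = - w.
  by rewrite /w -esB; ring.
have bal : q ^+ n * (- q * X * (q * c)) = q * W * s * (- (q ^+ m * s)).
  have -> : s = qh * ah * ch by [].
  by rewrite /X /W -hqh -hah -hch; field_nz; rewrite -?exprM expf_neq0.
have mq0 : - q != 0 by rewrite oppr_eq0.
have ms0 : - (q ^+ m * s) != 0 by rewrite oppr_eq0 mulf_neq0.
have qc0 : q * c != 0 by rewrite mulf_neq0.
have := sears_rev hq0 W0 mq0 X0 qc0 s0 ms0 bal Hq HW Hmq HX Hc.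
rewrite eB esB etB => /(_ Hvn Hmw).
have -> : - q / W = - (q ^+ l * y) by rewrite /W /y; field_nz.
have -> : X / W = A by rewrite /X /W /A /y; field_nz.
have -> : q / (q ^+ n * W) = q ^+ l * y ^+ 2 by rewrite /W /y; field_nz.
rewrite -/y => S.
have -> : phi43 n y W s (- (q ^+ m * s)) (- q) X (q * c) q q =
    \sum_(k < n.+1) P y k * P W k * P s k * P (- (q ^+ m * s)) k
      / (P q k * P (- q) k * P X k * P (q * c) k) * q ^+ k.
  by apply: eq_bigr => k _; rewrite /qpochs !big_cons !big_nil !mulr1 !mulrA.
rewrite {}S.
set Phi := \sum_(k < n.+1) _.
have Ev : v ^+ 2 * q ^+ m = q * A * B.
  have -> : v ^+ 2 = y ^+ 2 * u ^+ 2 by rewrite exprMn.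
  by rewrite us /A /B; ring.
have Es : s = v / B by rewrite -esB mulfK.
have HAB1 : P (A / B) m.+1 != 0.
  by rewrite qpochSr mulf_neq0 // [A / B * _]mulrC.
pose cj j := (q ^+ 3 / v) ^+ j
    * ((1 - q ^+ m * (A / B) / q ^+ (j + j)) / (1 - q ^+ m * (A / B)))
    * (P (q ^+ m)^-1 j * P B j * P (B / (q ^+ m * A)) j
       / (P q j * P (q / (q ^+ m * A)) j * P (q * B / A) j)).
pose g j k := P y k * P (- (q ^+ l * y)) k * P (A * q ^+ (m - j)) k * P (B * q ^+ j) k
   / (P q k * P (q ^+ l * y ^+ 2) k * P w k * P (- w) k) * q ^+ k.
have ePhi : Phi = P A m * P s m / (P (A / B) m * P v m) *
    \sum_(j < m.+1) cj j * \sum_(k < n.+1) g j k.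
  have -> : \sum_(j < m.+1) cj j * (\sum_(k < n.+1) g j k) =
      \sum_(k < n.+1) \sum_(j < m.+1) cj j * g j k.
    by rewrite [RHS]exchange_big /=; apply: eq_bigr => j _; rewrite mulr_sumr.
  rewrite /Phi mulr_sumr; apply: eq_bigr => -[k /= kn] _; rewrite ltnS in kn.
  have E := shift_expand hq0 A0 B0 v0 Ev Es Hqm HA HAB1 HBA (Hvmk k kn).
  transitivity (P A k * P B k / P v k * (P y k * P (- (q ^+ l * y)) k
     / (P q k * P (q ^+ l * y ^+ 2) k * P (- w) k) * q ^+ k)).
    by rewrite !invfM; ring.
  rewrite E -[LHS]mulrA; congr (_ * _); rewrite mulr_suml; apply: eq_bigr => j _.
  by rewrite /cj /g /w !invfM; ring.
rewrite ePhi; set C1 := P A m * P s m / _.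
set T := \sum_(j < m.+1) _.
have -> : \sum_(i < l.+1) \sum_(j < m.+1) Tterm q a c qh ah ch l m n i j = T.
  rewrite exchange_big /=; apply: eq_bigr => -[j /= jm] _; rewrite ltnS in jm.
  (* The powers q^(m-j) and q^j combine to q^m, so every j satisfies the q-Watson relation with the
     same w. *)
  have Ewj : w ^+ 2 = q * (A * q ^+ (m - j)) * (B * q ^+ j).
    have mj : q ^+ m = q ^+ (m - j) * q ^+ j by rewrite -exprD subnK.
    transitivity (v ^+ 2 * q ^+ m * q ^+ m); first by rewrite /w; ring.
    by rewrite Ev {1}mj; ring.
  rewrite /g (q_watson_ext hq0 Ewj hln Hq2 Hmq Hw Hmw) mulr_sumr.
  apply: eq_bigr => i _; rewrite Tterm_factor //.
by rewrite !invfM; ring.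
Qed.

End Expansions.

Theorem mainTheorem12 (R : realType) (q a c qh ah ch : R[i]) (l m n : nat)
  (hq0 : q != 0) (ha0 : a != 0) (hc0 : c != 0)
  (hqh : qh ^+ 2 = q) (hah : ah ^+ 2 = a) (hch : ch ^+ 2 = c)
  (hln : (l <= n)%N)
  (* no zero factor in a denominator: left-hand side *)
  (hd_phi : qpochs [:: q; - q; q ^ (1 - l%:Z + m%:Z) * a; q * c] q n != 0)
  (* the two prefactors *)
  (hd_n : qpochs [:: q ^ (1 - l%:Z + m%:Z) * a; q ^ (- n%:Z) / c; - q] q n != 0)
  (hd_m : qpochs [:: q ^+ m * a * c; q ^ (- n%:Z) * (qh * ah / ch)] q m != 0)
  (* the terms of the double sum *)
  (hd_T0 : 1 - q ^+ (2 * m) * a * c != 0)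
  (hd_Tj : forall j : nat, (j <= m)%N ->
     qpochs [:: q; q ^ (1 - 2 * m%:Z + n%:Z) / a;
                q ^ (1 - m%:Z) / (a * c)] q j != 0)
  (hd_Ti : forall i : nat, (i <= l)%N ->
     qpochs [:: q; q ^ (m%:Z - n%:Z) * (qh * ah / ch);
                - (q ^ (m%:Z - n%:Z) * (qh * ah / ch));
                q ^ (l%:Z - 2 * n%:Z); q ^ (i%:Z - 2 * n%:Z - 1)] q i != 0)
  (hd_Tq2 : forall i : nat, (i <= l)%N ->
     qpochs [:: q; q ^ (1 + 2 * m%:Z - 2 * n%:Z + 2 * i%:Z) * a / c]
            (q ^+ 2) (n - i) != 0) :
  phi43 n (q ^ (- n%:Z)) (q ^ (1 - l%:Z + n%:Z)) (qh * ah * ch)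
        (- (q ^+ m * (qh * ah * ch)))
        (- q) (q ^ (1 - l%:Z + m%:Z) * a) (q * c) q q
  = qpochs [:: q ^ (- n%:Z) * (qh * ah / ch);
               - (q ^ (m%:Z - n%:Z) * (qh * ah / ch));
               q ^ (1 - l%:Z + n%:Z)] q n
    / qpochs [:: q ^ (1 - l%:Z + m%:Z) * a; q ^ (- n%:Z) / c; - q] q n
    * (qpochs [:: q ^ (m%:Z - n%:Z) * a; qh * ah * ch] q m
       / qpochs [:: q ^+ m * a * c; q ^ (- n%:Z) * (qh * ah / ch)] q m)
    * \sum_(i < l.+1) \sum_(j < m.+1) Tterm q a c qh ah ch l m n i j.
Proof.
apply: phi43_double_sum => //; first exact: hd_Tj.
by have := hd_Tq2 0%N isT; rewrite subn0 mulr0 addr0.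
Qed.
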